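(* Let $n\ge3$. In the character variety $\mathrm{Rep}(\pi_1(\Sigma_{0,n}),G)=\mathrm{Hom}(\pi_1(\Sigma_{0,n}),G)/G$, where $G=\mathrm{PSL}(2,\mathbb R)$, the subset of (conjugacy classes of) super-maximal representations is compact.
   Context: $\Sigma_{0,n}$ is the oriented sphere minus $n$ points (punctures). $G=\mathrm{PSL}(2,\mathbb R)$ acts by orientation-preserving isometries on $\mathbb H^+=\{\Im z>0\}$ with the metric $(dx^2+dy^2)/y^2$. $\mathrm{Rep}(\pi_1(\Sigma_{0,n}),G)$ is the set-theoretic quotient of $\mathrm{Hom}(\pi_1(\Sigma_{0,n}),G)$ by conjugation, with the quotient topology; it is not Hausdorff, and compact means that every open cover has a finite subcover. The $c_i\in\pi_1(\Sigma_{0,n})$, $1\le i\le n$, are elements freely homotopic to positive loops around the punctures. The function $\theta:G\to[0,2\pi]$ is: $\theta(g)=0$ if $g$ is hyperbolic or positive parabolic (a parabolic translating its horocycles anti-clockwise, i.e. conjugate in $G$ to $z\mapsto z+1$); $\theta(g)=2\pi$ if $g$ is negative parabolic (the other parabolics) or the identity; $\theta(g)\in(0,2\pi)$ is the rotation angle of $g$ on $\mathbb H^+$ if $g$ is elliptic. Put $\theta_i(\rho)=\theta(\rho(c_i))$ and $\Theta(\rho)=\sum_{i=1}^n\theta_i(\rho)$. The volume $\mathrm{Vol}(\rho)$ is $\int_{\Sigma_{0,n}} f^*\big(\frac{dx\wedge dy}{y^2}\big)$ for a smooth $\rho$-equivariant map $f:\widetilde{\Sigma_{0,n}}\to\mathbb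 H^+$ such that, near each puncture, the completion of $f^*\big(\frac{dx^2+dy^2}{y^2}\big)$ is a cone, a parabolic cusp, or an annulus with totally geodesic boundary. Equivalently (known formula of Burger--Iozzi--Wienhard), $\mathrm{Vol}(\rho)=-\sum_{i=1}^n T(\tilde\rho(c_i))$, where $\tilde\rho$ is any lift of $\rho$ to the universal cover $\widetilde G$ of $G$ and $T(g)=\lim_k (g^k(x)-x)/k$ is the translation number, $\widetilde{\mathbb R\mathbf P^1}$ being identified with $\mathbb R$ (oriented anti-clockwise as the boundary of $\mathbb H^+$) so that the positive generator of the covering group is $x\mapsto x+2\pi$. The relative Euler class is $\mathbf{eu}(\rho)=\frac1{2\pi}\big(\mathrm{Vol}(\rho)+\Theta(\rho)\big)\in\mathbb Z$. A representation $\rho:\pi_1(\Sigma_{0,n})\to G$ is super-maximal if $\mathbf{eu}(\rho)=n-1$ or $\mathbf{eu}(\rho)=n$. *)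

(* Defs.v *)
From HB Require Import structures.
From mathcomp Require Import all_boot all_order all_algebra.
From mathcomp Require Import all_classical all_reals all_analysis.
From mathcomp Require Import complex.

Set Implicit Arguments.
Unset Strict Implicit.
Unset Printing Implicit Defensive.

Import Order.TTheory GRing.Theory Num.Theory.
Import numFieldTopology.Exports numFieldNormedType.Exports.

Local Open Scope classical_set_scope.
Local Open Scope quotient_scope.
Local Open Scope ring_scope.

Section SL2.
Variable R : realType.

Record SL2 := MkSL2 { SL2_mx :> 'M[R]_2; _ : \det SL2_mx == 1 }.

HB.instance Definition _ := [isSub for SL2_mx].
HB.instance Definition _ := [Choice of SL2 by <:].
HB.instance Definition _ := Topological.copy SL2 (initial_topology SL2_mx).

Implicit Types A B : SL2.

Lemma SL2_det A : \det (A : 'M[R]_2) = 1. Proof. exact/eqP/(valP A). Qed.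

Lemma SL2_unitmx A : (A : 'M[R]_2) \in unitmx.
Proof. by rewrite unitmxE SL2_det unitr1. Qed.

Fact SL2_one_subproof : \det (1%:M : 'M[R]_2) == 1.
Proof. by rewrite det1. Qed.
Fact SL2_mul_subproof A B : \det (A *m B) == 1.
Proof. by rewrite det_mulmx !SL2_det mulr1. Qed.
Fact SL2_inv_subproof A : \det (invmx A) == 1.
Proof. by rewrite det_inv SL2_det invr1. Qed.

Definition SL2_one := MkSL2 SL2_one_subproof.
Definition SL2_mul A B := MkSL2 (SL2_mul_subproof A B).
Definition SL2_inv A := MkSL2 (SL2_inv_subproof A).

Fact SL2_mulA : associative SL2_mul.
Proof. by move=> A B C; apply: val_inj; exact: mulmxA. Qed.
Fact SL2_mul1 : left_id SL2_one SL2_mul.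
Proof. by move=> A; apply: val_inj; exact: mul1mx. Qed.
Fact SL2_mulr1 : right_id SL2_one SL2_mul.
Proof. by move=> A; apply: val_inj; exact: mulmx1. Qed.
Fact SL2_mulV : left_inverse SL2_one SL2_inv SL2_mul.
Proof. by move=> A; apply: val_inj; exact: mulVmx (SL2_unitmx A). Qed.
Fact SL2_mulrV : right_inverse SL2_one SL2_inv SL2_mul.
Proof. by move=> A; apply: val_inj; exact: mulmxV (SL2_unitmx A). Qed.

HB.instance Definition _ :=
  isGroup.Build SL2 SL2_mulA SL2_mul1 SL2_mulr1 SL2_mulV SL2_mulrV.

Definition SL2_pm A B := (SL2_mx A == SL2_mx B) || (SL2_mx A == - SL2_mx B).

Fact SL2_pm_refl : reflexive SL2_pm.
Proof. by move=> A; rewrite /SL2_pm eqxx. Qed.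
Fact SL2_pm_sym : symmetric SL2_pm.
Proof.
by move=> A B; rewrite /SL2_pm eq_sym -eqr_oppLR [- _ == _]eq_sym.
Qed.
Fact SL2_pm_trans : transitive SL2_pm.
Proof.
move=> B A C; rewrite /SL2_pm => /orP[]/eqP-> /orP[]/eqP->;
  by rewrite ?opprK eqxx ?orbT.
Qed.
Canonical SL2_pm_equiv := EquivRel SL2_pm SL2_pm_refl SL2_pm_sym SL2_pm_trans.

Fact SL2_pm_mul A A' B B' :
  SL2_pm A A' -> SL2_pm B B' -> SL2_pm (A * B)%g (A' * B')%g.
Proof.
by rewrite /SL2_pm /= => /orP[]/eqP-> /orP[]/eqP->;
  rewrite ?mulNmx ?mulmxN ?opprK eqxx ?orbT.
Qed.
Fact SL2_pm_inv A A' : SL2_pm A A' -> SL2_pm A^-1%g A'^-1%g.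
Proof.
rewrite /SL2_pm /= => /orP[]/eqP->; first by rewrite eqxx.
by rewrite -scaleN1r invmxZ ?unitmxZ ?unitrN1 ?SL2_unitmx// invrN1 scaleN1r eqxx orbT.
Qed.

Definition PSL2 := quotient_topology {eq_quot SL2_pm_equiv}.

HB.instance Definition _ := Topological.on PSL2.
HB.instance Definition _ := Quotient.on PSL2.

Implicit Types g h : PSL2.

Definition PSL2_one := \pi_PSL2 (1%g : SL2).
Definition PSL2_mul g h := \pi_PSL2 (repr g * repr h)%g.
Definition PSL2_inv g := \pi_PSL2 ((repr g)^-1)%g.

Lemma PSL2_eqP A B : reflect (\pi_PSL2 A = \pi_PSL2 B) (SL2_pm A B).
Proof. exact: (@eqquotP _ SL2_pm_equiv). Qed.

Lemma PSL2_repr_pm A : SL2_pm (repr (\pi_PSL2 A)) A.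
Proof. by apply/PSL2_eqP; rewrite reprK. Qed.

Lemma PSL2_mulE A B : PSL2_mul (\pi_PSL2 A) (\pi_PSL2 B) = \pi_PSL2 (A * B)%g.
Proof. by apply/PSL2_eqP/SL2_pm_mul; exact: PSL2_repr_pm. Qed.

Lemma PSL2_invE A : PSL2_inv (\pi_PSL2 A) = \pi_PSL2 (A^-1)%g.
Proof. by apply/PSL2_eqP/SL2_pm_inv; exact: PSL2_repr_pm. Qed.

Fact PSL2_mulA : associative PSL2_mul.
Proof.
move=> g h k; rewrite -(reprK g) -(reprK h) -(reprK k).
move: (repr g) (repr h) (repr k) => A B C.
by rewrite (PSL2_mulE B C) (PSL2_mulE A B) !PSL2_mulE mulgA.
Qed.
Fact PSL2_mul1 : left_id PSL2_one PSL2_mul.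
Proof. by move=> g; rewrite -(reprK g) PSL2_mulE mul1g. Qed.
Fact PSL2_mulr1 : right_id PSL2_one PSL2_mul.
Proof. by move=> g; rewrite -(reprK g) PSL2_mulE mulg1. Qed.
Fact PSL2_mulV : left_inverse PSL2_one PSL2_inv PSL2_mul.
Proof. by move=> g; rewrite -(reprK g) PSL2_invE PSL2_mulE mulVg. Qed.
Fact PSL2_mulrV : right_inverse PSL2_one PSL2_inv PSL2_mul.
Proof. by move=> g; rewrite -(reprK g) PSL2_invE PSL2_mulE mulgV. Qed.

HB.instance Definition _ :=
  isGroup.Build PSL2 PSL2_mulA PSL2_mul1 PSL2_mulr1 PSL2_mulV PSL2_mulrV.

End SL2.

Section Theta.
Variable R : realType.
Implicit Types g h : PSL2 R.

Definition mobius (A : 'M[R]_2) (z : R[i]) : R[i] :=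
  ((A 0 0)%:C * z + (A 0 1)%:C)%C / ((A 1 0)%:C * z + (A 1 1)%:C)%C.

(* The derivative of [mobius A] when \det A = 1. *)
Definition mobius_deriv (A : 'M[R]_2) (z : R[i]) : R[i] :=
  (((A 1 0)%:C * z + (A 1 1)%:C) ^- 2)%C.

Definition hyperbolic g : bool := 2 < `| \tr (repr g) |.
Definition elliptic g : bool := `| \tr (repr g) | < 2.

Definition translation_mx : 'M[R]_2 :=
  1%:M + delta_mx 0 1.

Fact translation_mx_det : \det translation_mx == 1.
Proof.
rewrite (expand_det_row _ 0) !big_ord_recl big_ord0 /cofactor !det_mx11 !mxE /=.
by rewrite !(addr0, add0r, mulr1, mulr0, expr0).
Qed.

(* The class of z |-> z + 1. *)
Definition translation1 : PSL2 R := \pi_(PSL2 R) (MkSL2 translation_mx_det).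

Definition positive_parabolic g : Prop := exists h, g = (translation1 ^ h)%g.

(* t in ]0, 2 pi[ such that g fixes a point z of the upper half-plane and its
   differential at z is the multiplication by e^(it); unique for elliptic g. *)
Definition rotation_angle g : R :=
  xget 0 [set t | 0 < t < 2 * pi /\
    exists z : R[i], [/\ 0 < complex.Im z, mobius (repr g) z = z &
      mobius_deriv (repr g) z = (cos t +i* sin t)%C]].

(* The last case consists of the negative parabolics and the identity. *)
Definition theta g : R :=
  if hyperbolic g || `[< positive_parabolic g >] then 0
  else if elliptic g then rotation_angle g
  else 2 * pi.

End Theta.

Section PuncturedSphereGroup.
Variable n : nat.

Definition word := seq ('I_n * bool).

(* (i, true) stands for c_i and (i, false) for its inverse. *)
Inductive pi1_rel : word -> word -> Prop :=
| pi1_rel_refl w : pi1_rel w w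
| pi1_rel_sym v w : pi1_rel v w -> pi1_rel w v
| pi1_rel_trans u v w : pi1_rel u v -> pi1_rel v w -> pi1_rel u w
| pi1_rel_cat v v' w w' :
    pi1_rel v v' -> pi1_rel w w' -> pi1_rel (v ++ w) (v' ++ w')
| pi1_rel_cancel i b : pi1_rel [:: (i, b); (i, ~~ b)] [::]
| pi1_rel_boundary : pi1_rel [seq (i, true) | i <- enum 'I_n] [::].

Definition pi1_eqv v w := `[< pi1_rel v w >].

Fact pi1_eqv_refl : reflexive pi1_eqv.
Proof. by move=> w; apply/asboolP; exact: pi1_rel_refl. Qed.
Fact pi1_eqv_sym : symmetric pi1_eqv.
Proof.
by move=> v w; apply/asboolP/asboolP; exact: pi1_rel_sym.
Qed.
Fact pi1_eqv_trans : transitive pi1_eqv.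
Proof.
move=> v u w /asboolP uv /asboolP vw; apply/asboolP.
exact: pi1_rel_trans uv vw.
Qed.
Canonical pi1_equiv := EquivRel pi1_eqv pi1_eqv_refl pi1_eqv_sym pi1_eqv_trans.

(* The fundamental group of the sphere with n punctures,
   < c_0, ..., c_(n-1) | c_0 * ... * c_(n-1) = 1 >. *)
Definition pi1 := {eq_quot pi1_equiv}.

HB.instance Definition _ := Choice.on pi1.
HB.instance Definition _ := Quotient.on pi1.

Definition word_inv (w : word) : word := rev [seq (x.1, ~~ x.2) | x <- w].

Lemma word_invr (w : word) : pi1_rel (w ++ word_inv w) [::].
Proof.
elim: w => [|[i b] w IHw]; first exact: pi1_rel_refl.
have -> : ((i, b) :: w) ++ word_inv ((i, b) :: w) =
    [:: (i, b)] ++ (w ++ word_inv w) ++ [:: (i, ~~ b)].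
  by rewrite /word_inv /= rev_cons -cats1 catA.
apply: pi1_rel_trans (pi1_rel_cancel i b).
apply: (@pi1_rel_cat [:: (i, b)] [:: (i, b)] _ [:: (i, ~~ b)]).
  exact: pi1_rel_refl.
rewrite -[X in pi1_rel _ X]cat0s.
by apply: pi1_rel_cat => //; exact: pi1_rel_refl.
Qed.

Lemma word_invK : involutive word_inv.
Proof.
move=> w; rewrite /word_inv map_rev revK -map_comp -[RHS]map_id.
by apply: eq_map => -[i b] /=; rewrite negbK.
Qed.

Lemma word_invl (w : word) : pi1_rel (word_inv w ++ w) [::].
Proof. by rewrite -{2}(word_invK w); exact: word_invr. Qed.

Lemma pi1_rel_inv v w : pi1_rel v w -> pi1_rel (word_inv v) (word_inv w).
Proof.
move=> vw; apply: (@pi1_rel_trans _ (word_inv v ++ (v ++ word_inv w))).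
  rewrite -[X in pi1_rel X _]cats0.
  apply: pi1_rel_cat; first exact: pi1_rel_refl.
  apply: pi1_rel_sym; apply: pi1_rel_trans (word_invr w).
  by apply: pi1_rel_cat => //; exact: pi1_rel_refl.
rewrite catA -[X in pi1_rel _ X]cat0s.
by apply: pi1_rel_cat; [exact: word_invl|exact: pi1_rel_refl].
Qed.

Implicit Types x y z : pi1.

Definition pi1_one := \pi_pi1 [::].
Definition pi1_mul x y := \pi_pi1 (repr x ++ repr y).
Definition pi1_inv x := \pi_pi1 (word_inv (repr x)).

Lemma pi1_eqP (v w : word) : \pi_pi1 v = \pi_pi1 w <-> pi1_rel v w.
Proof. by split=> [/eqquotP/asboolP//|vw]; exact/eqquotP/asboolP. Qed.

Lemma pi1_repr_rel (w : word) : pi1_rel (repr (\pi_pi1 w)) w.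
Proof. by apply/pi1_eqP; rewrite reprK. Qed.

Lemma pi1_mulE (v w : word) : pi1_mul (\pi_pi1 v) (\pi_pi1 w) = \pi_pi1 (v ++ w).
Proof. by apply/pi1_eqP/pi1_rel_cat; exact: pi1_repr_rel. Qed.

Lemma pi1_invE (w : word) : pi1_inv (\pi_pi1 w) = \pi_pi1 (word_inv w).
Proof. by apply/pi1_eqP/pi1_rel_inv; exact: pi1_repr_rel. Qed.

Fact pi1_mulA : associative pi1_mul.
Proof.
move=> x y z; rewrite -(reprK x) -(reprK y) -(reprK z).
move: (repr x) (repr y) (repr z) => u v w.
by rewrite (pi1_mulE v w) (pi1_mulE u v) !pi1_mulE catA.
Qed.
Fact pi1_mul1 : left_id pi1_one pi1_mul.
Proof. by move=> x; rewrite -(reprK x) pi1_mulE. Qed.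
Fact pi1_mulr1 : right_id pi1_one pi1_mul.
Proof. by move=> x; rewrite -(reprK x) pi1_mulE cats0. Qed.
Fact pi1_mulV : left_inverse pi1_one pi1_inv pi1_mul.
Proof.
move=> x; rewrite -(reprK x) pi1_invE pi1_mulE.
by apply/pi1_eqP; exact: word_invl.
Qed.
Fact pi1_mulrV : right_inverse pi1_one pi1_inv pi1_mul.
Proof.
move=> x; rewrite -(reprK x) pi1_invE pi1_mulE.
by apply/pi1_eqP; exact: word_invr.
Qed.

HB.instance Definition _ :=
  isGroup.Build pi1 pi1_mulA pi1_mul1 pi1_mulr1 pi1_mulV pi1_mulrV.

(* A positive loop around the i-th puncture. *)
Definition pi1_loop (i : 'I_n) := \pi_pi1 [:: (i, true)].

End PuncturedSphereGroup.

Section Representations.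
Variables (R : realType) (n : nat).

Definition HomPSL2 : Type := {multiplicative pi1 n -> PSL2 R}.

(* The topology of pointwise convergence. *)
HB.instance Definition _ := gen_eqMixin HomPSL2.
HB.instance Definition _ := gen_choiceMixin HomPSL2.
HB.instance Definition _ := Topological.copy HomPSL2
  (@initial_topology HomPSL2 {ptws pi1 n -> PSL2 R} (fun rho => rho : pi1 n -> PSL2 R)).

Implicit Types rho sigma : HomPSL2.

Definition conjugate rho sigma : Prop :=
  exists g, forall x, sigma x = (rho x ^ g)%g.

Definition conjugateb rho sigma := `[< conjugate rho sigma >].

Fact conjugateb_refl : reflexive conjugateb.
Proof. by move=> rho; apply/asboolP; exists 1%g => x; rewrite conjg1. Qed.
Fact conjugateb_sym : symmetric conjugateb.
Proof.
by move=> rho sigma; apply/asboolP/asboolP => -[g rs];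
  exists g^-1%g => x; rewrite rs conjgK.
Qed.
Fact conjugateb_trans : transitive conjugateb.
Proof.
move=> rho sigma tau /asboolP[g sr] /asboolP[h rt]; apply/asboolP.
by exists (g * h)%g => x; rewrite rt sr conjgM.
Qed.
Canonical conjugate_equiv :=
  EquivRel conjugateb conjugateb_refl conjugateb_sym conjugateb_trans.

Definition Rep := quotient_topology {eq_quot conjugate_equiv}.

HB.instance Definition _ := Topological.on Rep.
HB.instance Definition _ := Quotient.on Rep.

(* t |-> [sin (t/2) : cos (t/2)] identifies R with the universal cover of
   RP^1 = R \cup {oo}, the boundary of the upper half-plane; as a boundary
   value it is tan (t/2), so it is increasing (anti-clockwise), and its deck
   transformations are generated by t |-> t + 2 pi. *)
Definition RP1_cover (t : R) : 'cV[R]_2 :=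
  \col_i (if i == 0 then sin (t / 2) else cos (t / 2)).

(* The universal cover of PSL(2,R) is identified with the group of the
   continuous maps f : R -> R that lift the action on RP^1 of some g, the
   covering map sending f to g. *)
Definition lifts_elt (f : R -> R) (g : PSL2 R) : Prop :=
  continuous f /\
  forall t, exists2 s : R, s != 0 &
    SL2_mx (repr g) *m RP1_cover t = s *: RP1_cover (f t).

(* [rhot] is a homomorphism to the universal cover that projects to [rho]. *)
Definition lifts_rep (rhot : pi1 n -> R -> R) rho : Prop :=
  (forall x, lifts_elt (rhot x) (rho x)) /\
  (forall x y, rhot (x * y)%g = rhot x \o rhot y).

(* The limit of (f^k(t) - t) / k does not depend on t; here t = 0. *)
Definition translation_number (f : R -> R) : R :=
  limn (fun k => (iter k f 0 - 0) / k%:R).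

(* The volume of rho, through the Burger-Iozzi-Wienhard formula: the sum is
   the same for all the lifts of rho, and pi1 being free, lifts exist. *)
Definition Vol rho : R :=
  xget 0 [set v | exists2 rhot, lifts_rep rhot rho &
    v = - \sum_(i < n) translation_number (rhot (pi1_loop i))].

Definition Theta rho : R := \sum_(i < n) theta (rho (pi1_loop i)).

Definition euler_class rho : R := (Vol rho + Theta rho) / (2 * pi).

Definition super_maximal rho : Prop :=
  euler_class rho = n%:R - 1 \/ euler_class rho = n%:R.

End Representations.

(* Main.v *)
Require Import Defs.
From HB Require Import structures.
From mathcomp Require Import all_boot all_order all_algebra.
From mathcomp Require Import all_classical all_reals all_analysis.
From mathcomp Require Import complex ring lra zify.

Set Implicit Arguments.
Unset Strict Implicit.
Unset Printing Implicit Defensive.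

Import Order.TTheory GRing.Theory Num.Theory.
Import numFieldTopology.Exports numFieldNormedType.Exports.

Local Open Scope classical_set_scope.
Local Open Scope quotient_scope.
Local Open Scope ring_scope.

(** Write [tau] for the translation by [2 pi] of the line that covers RP^1.

The formula for the Euler class.  Each g in PSL(2,R) has a distinguished lift
to the line, of translation number [theta g]; composing it with [tau^-1] gives
a lift h of translation number [theta g - 2 pi] with [h t <= t] for all t
([theta_lift]): this is exactly what the convention for [theta] on parabolics
and on the identity achieves.  If h_i is this lift of rho(c_i), then
h_1 o ... o h_n lifts the identity, so it is [tau^-m] for an integer m, and the
Burger-Iozzi-Wienhard formula reads eu(rho) = n - m ([euler_classE]).  Hence rho
is super-maximal iff m is 0 or 1.  If m = 0, all h_i are the identity and rho is
trivial.

The bound.  Let m = 1.  All the h_i move points backwards and their product is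
only [tau^-1], so deleting factors from the product can only move points
forward: each h_i, and each h_i o h_j with i < j, lies between [tau^-1] and the
identity ([factor_itv], [factor2_ge]).  Matrices whose lift lies there are the
[backward] ones: for them the quadratic form v |-> det (v, A v) is nonnegative,
and |tr A| <= 2.  So the matrices A_i of the h_i satisfy |tr A_i| <= 2 and
|tr (A_i A_j)| <= 2.  The discriminant of the sum of the forms of the A_i is the
sum of the polar terms (tr A_i tr A_j - 2 tr (A_i A_j)) / 4, so it is at most
[2 n^2] ([quad_disc_le]).  Conjugating so that this sum (slightly perturbed, to make it
definite) becomes a multiple of x^2 + y^2 bounds every single form, because the
forms are nonnegative, and so bounds all the matrix entries ([balance]).

Compactness.  Up to conjugacy a super-maximal representation therefore comes
from a tuple of backward matrices with bounded entries, with product -1 and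
whose canonical lifts compose to [tau^-1].  The canonical lift of a backward
matrix is given by a formula which is jointly continuous in the matrix and the
point ([back_lift_cvg]), so these conditions are closed and the tuples form a
compact set ([bounded_chain_compact]).  Conversely every such tuple defines a
super-maximal representation ([bounded_chain_super_maximal]), trivial as soon as
one of the matrices is -1.  The set of super-maximal classes is thus the image
of a compact set under a continuous map. *)

(** * Trigonometry *)
Section Trig.
Variable R : realType.
Implicit Types (x y t : R).

Lemma floor_2pi x : exists2 m : int,
  m%:~R * (2 * pi) <= x & x < m%:~R * (2 * pi) + 2 * pi.
Proof.
have p2 : 0 < 2 * pi :> R by rewrite mulr_gt0// pi_gt0.
exists (Num.floor (x / (2 * pi))); first by rewrite -ler_pdivlMr// ge_floor.
by have := floorD1_gt (x / (2 * pi)); rewrite ltr_pdivrMr// intrD mulrDl mul1r.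
Qed.

Lemma intmul_small_eq0 (m : int) x : 0 < x -> `|m%:~R * x| < x -> m = 0.
Proof.
move=> x0; rewrite normrM (gtr0_norm x0) gtr_pMl// -intr_norm (_ : 1 = 1%:~R)//.
by rewrite ltr_int; lia.
Qed.

Lemma sin_gt0_itv x : - pi < x < 2 * pi -> 0 < sin x -> 0 < x < pi.
Proof.
move=> /andP[x1 x2] sx; have [x0|x0] := leP x 0.
  have : 0 <= sin (- x) by apply: sin_ge0_pi; apply/andP; split; lra.
  by rewrite sinN; lra.
have [//|xpi] := ltP x pi.
have : 0 <= sin (x - pi) by apply: sin_ge0_pi; apply/andP; split; lra.
by rewrite -(subrK pi x) sinDpi in sx *; rewrite addrK; lra.
Qed.

Lemma normr_sinDpin x (n : nat) : `|sin (x + n%:R * pi)| = `|sin x|.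
Proof.
elim: n => [|n IHn]; first by rewrite mul0r addr0.
by rewrite -natr1 mulrDl mul1r addrA sinDpi normrN.
Qed.

Lemma normr_sinDpiz x (m : int) : `|sin (x + m%:~R * pi)| = `|sin x|.
Proof.
case: m => n; first exact: normr_sinDpin.
rewrite NegzE mulrNz mulNr -[in RHS](subrK (n.+1%:R * pi) x) normr_sinDpin.
by [].
Qed.

Lemma sin_eq0 x : sin x = 0 -> exists m : int, x = m%:~R * pi.
Proof.
move=> sx; have pi0 := pi_gt0 R; set m := Num.floor (x / pi); exists m.
have [m1 m2] : m%:~R * pi <= x /\ x < m%:~R * pi + pi.
  split; first by rewrite -ler_pdivlMr// ge_floor.
  by rewrite -[X in _ + X]mul1r -mulrDl -ltr_pdivrMr// -intrD1 floorD1_gt.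
have [->//|ne] := eqVneq x (m%:~R * pi).
have sp : 0 < sin (x - m%:~R * pi).
  apply: sin_gt0_pi; apply/andP; split; last lra.
  by rewrite subr_gt0 lt_neqAle eq_sym ne.
have := normr_sinDpiz (x - m%:~R * pi) m.
rewrite subrK sx normr0 (gtr0_norm sp) => s0.
by rewrite -s0 ltxx in sp.
Qed.

Lemma cos_eq1 x : cos x = 1 -> exists m : int, x = m%:~R * (2 * pi).
Proof.
move=> cx; have /sin_eq0[m xm] : sin (x / 2) = 0.
  apply/eqP; rewrite -sqrf_eq0 sin2cos2; apply/eqP.
  have : cos (x / 2 *+ 2) = 1 by rewrite -mulr_natr divfK.
  by rewrite cos_mulr2n -mulr_natr; lra.
by exists m; rewrite mulrCA mulrC -xm divfK.
Qed.

(** The half-angle formula: off the negative half-line, [2 * atan (y / (r + x))] is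
an argument of the point of coordinates x and y. *)
Lemma polar_atan x y (r := Num.sqrt (x ^+ 2 + y ^+ 2))
    (a := atan (y / (r + x))) :
  0 < r + x -> r * cos (a *+ 2) = x /\ r * sin (a *+ 2) = y.
Proof.
move=> rx; set T := y / (r + x).
have r2 : r ^+ 2 = x ^+ 2 + y ^+ 2 by rewrite sqr_sqrtr// addr_ge0// sqr_ge0.
have T0 : 0 < 1 + T ^+ 2 by rewrite ltr_pwDl// sqr_ge0.
have ca2 : cos a ^+ 2 * (1 + T ^+ 2) = 1.
  by rewrite /a cos_atan exprVn sqr_sqrtr ?ltW// mulVf// gt_eqF.
have sa : sin a = T * cos a.
  have ca : cos a != 0.
    apply/eqP => ca0; move: ca2; rewrite ca0 expr0n mul0r => /esym/eqP.
    by rewrite oner_eq0.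
  have := atanK T; rewrite -/a /tan => /(congr1 ( *%R^~ (cos a))).
  by rewrite divfK.
have ry : T * (r + x) = y by rewrite divfK// gt_eqF.
have ca2' : cos a ^+ 2 * (2 * r) = r + x.
  apply: (mulIf (lt0r_neq0 rx)).
  transitivity (cos a ^+ 2 * ((r + x) ^+ 2 + y ^+ 2)).
    by rewrite -mulrA; congr (_ * _); ring: r2.
  rewrite -ry -expr2.
  transitivity (cos a ^+ 2 * (1 + T ^+ 2) * (r + x) ^+ 2); first ring.
  by rewrite ca2 mul1r.
rewrite cos_mulr2n sin_mulr2n sa !mulr2n; split.
  by ring: ca2'.
transitivity (T * (cos a ^+ 2 * (2 * r))); first ring.
by rewrite ca2'.
Qed.

End Trig.

(** * Two by two matrices *)
Section Mat2.
Variable R : comNzRingType.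
Implicit Types A B : 'M[R]_2.

Lemma det22 A : \det A = A 0 0 * A 1 1 - A 0 1 * A 1 0.
Proof.
rewrite (expand_det_row _ 0) !big_ord_recl big_ord0 /cofactor !det_mx11 !mxE /=.
rewrite !(expr0, expr1, addr0, mul1r, mulN1r, mulrN).
by congr (_ * A _ _ - A _ _ * A _ _); apply/val_inj.
Qed.

Lemma tr22 A : \tr A = A 0 0 + A 1 1.
Proof.
rewrite /mxtrace !big_ord_recl big_ord0 addr0.
by congr (_ + A _ _); apply/val_inj.
Qed.

Lemma mul22 n A (B : 'M[R]_(2, n)) i j :
  (A *m B) i j = A i 0 * B 0 j + A i 1 * B 1 j.
Proof.
rewrite mxE !big_ord_recl big_ord0 addr0.
by congr (_ + A _ _ * B _ _); apply/val_inj.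
Qed.

Lemma ord2P (P : 'I_2 -> Prop) : P 0 -> P 1 -> forall i, P i.
Proof.
move=> P0 P1 [[|[|//]] lti].
  by rewrite (_ : Ordinal _ = 0)//; apply/val_inj.
by rewrite (_ : Ordinal _ = 1)//; apply/val_inj.
Qed.

End Mat2.

(** * Lifts to the universal cover of RP^1 *)
Section Carries.
Variable R : realType.
Implicit Types (A B : 'M[R]_2) (t x y : R) (f g : R -> R).

(** The positivity of the factor distinguishes A from - A: it determines x modulo
[4 * pi], whereas the action on RP^1 only determines it modulo [2 * pi]. *)
Definition carries A t x : Prop :=
  exists2 r : R, 0 < r & A *m RP1_cover t = r *: RP1_cover x.

Lemma carriesP A t x : carries A t x <-> exists2 r : R, 0 < r &
  A 0 0 * sin (t / 2) + A 0 1 * cos (t / 2) = r * sin (x / 2) /\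
  A 1 0 * sin (t / 2) + A 1 1 * cos (t / 2) = r * cos (x / 2).
Proof.
split=> -[r r0 E]; exists r => //.
  have E0 := congr1 (fun M : 'cV[R]_2 => M 0 0) E.
  have E1 := congr1 (fun M : 'cV[R]_2 => M 1 0) E.
  by move: E0 E1; rewrite !mul22 !mxE /=.
apply/matrixP => i j; rewrite ord1 mul22 !mxE /=.
by move: i; apply: ord2P; case: E.
Qed.

Lemma carries_mul A B t x y :
  carries A x y -> carries B t x -> carries (A *m B) t y.
Proof.
move=> [r r0 Ar] [s s0 Bs]; exists (s * r); first exact: mulr_gt0.
by rewrite -mulmxA Bs -scalemxAr Ar scalerA.
Qed.

Lemma carries_uniq A t x y :
  carries A t x -> carries A t y -> exists m : int, x = y + m%:~R * (4 * pi).
Proof.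
move=> /carriesP[r r0 [E1 E2]] /carriesP[s s0 []]; rewrite E1 E2 => F1 F2.
have cs z := cos2Dsin2 (z : R).
have rs : r = s.
  apply/eqP; rewrite -(eqrXn2 (n:=2))// ?ltW//; apply/eqP.
  have sq z c : c ^+ 2 = (c * cos z) ^+ 2 + (c * sin z) ^+ 2 :> R.
    by rewrite !exprMn -mulrDr cs mulr1.
  by rewrite (sq (x / 2) r) F1 F2 -sq.
have /cos_eq1[m xy] : cos (x / 2 - y / 2) = 1.
  have r_neq0 : r != 0 by rewrite gt_eqF.
  move: F1 F2; rewrite -rs => /(mulfI r_neq0) F1 /(mulfI r_neq0) F2.
  by rewrite cosB F1 F2 -!expr2 cs.
by exists m; lra.
Qed.

(** Up to positive factors the two sines are the areas spanned by two vectors and by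
their images under A. *)
Lemma carries_det A t t' x x' : \det A = 1 ->
  carries A t x -> carries A t' x' ->
  exists2 r : R, 0 < r & sin ((t' - t) / 2) = r * sin ((x' - x) / 2).
Proof.
rewrite det22 => dA /carriesP[r r0 [E1 E2]] /carriesP[s s0 [F1 F2]].
exists (r * s); first exact: mulr_gt0.
rewrite !mulrBl !sinB.
transitivity ((s * sin (x' / 2)) * (r * cos (x / 2)) -
  (s * cos (x' / 2)) * (r * sin (x / 2))); last ring.
rewrite -E1 -E2 -F1 -F2 -[LHS]mul1r -dA; ring.
Qed.

Lemma RP1_coverD2pi t : RP1_cover (t + 2 * pi) = - RP1_cover t.
Proof.
apply/matrixP => i j; rewrite !mxE.
have -> : (t + 2 * pi) / 2 = t / 2 + pi by lra.
by rewrite sinDpi cosDpi; case: ifP.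
Qed.

Lemma carriesD2pi A t x : carries A t x -> carries A (t + 2 * pi) (x + 2 * pi).
Proof.
move=> [r r0 E]; exists r => //.
by rewrite !RP1_coverD2pi mulmxN E scalerN.
Qed.

Lemma carriesN A t x : carries A t x -> carries (- A) t (x + 2 * pi).
Proof.
by move=> [r r0 E]; exists r => //; rewrite mulNmx RP1_coverD2pi E scalerN.
Qed.

Lemma polar x y : (x != 0) || (y != 0) ->
  exists t, exists2 r : R, 0 < r & x = r * sin (t / 2) /\ y = r * cos (t / 2).
Proof.
move=> xy0; set r := Num.sqrt (y ^+ 2 + x ^+ 2).
have r2 : r ^+ 2 = y ^+ 2 + x ^+ 2 by rewrite sqr_sqrtr// addr_ge0// sqr_ge0.
have r0 : 0 < r.
  rewrite sqrtr_gt0 lt_neqAle addr_ge0 ?sqr_ge0// andbT eq_sym.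
  by rewrite paddr_eq0 ?sqr_ge0// !sqrf_eq0 negb_and orbC.
have [ry|ry] := ltP 0 (r + y).
  have [ec es] := polar_atan ry; exists (atan (x / (r + y)) *+ 4), r => //.
  rewrite (_ : atan _ *+ 4 / 2 = atan (x / (r + y)) *+ 2); first by rewrite ec es.
  by rewrite -[_ *+ 4]mulr_natr -[_ *+ 2 in RHS]mulr_natr; lra.
have x0 : x = 0.
  have : r ^+ 2 <= y ^+ 2.
    by rewrite -[y ^+ 2]sqrrN ler_sqr ?nnegrE; [lra|lra|lra].
  rewrite r2 gerDl => x2; apply/eqP.
  by rewrite -sqrf_eq0 eq_le x2 sqr_ge0.
have y0 : y = - r.
  have : (r - y) * (r + y) = 0.
    by rewrite -subr_sqr r2 x0 expr0n addr0 subrr.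
  by move/eqP; rewrite mulf_eq0 => /orP[]/eqP; lra.
exists (2 * pi), r => //; have -> : 2 * pi / 2 = pi :> R by lra.
by rewrite sinpi cospi x0 y0 mulr0 mulrN1.
Qed.

End Carries.

Section Lifts.
Variable R : realType.
Implicit Types (A B : 'M[R]_2) (t x y : R) (f g : R -> R).

(** An element of the universal cover of SL(2,R) above A. *)
Record is_lift A f : Prop := IsLift {
  lift_continuous : continuous f;
  liftD2pi : forall t, f (t + 2 * pi) = f t + 2 * pi;
  lift_incr : {homo f : x y / x < y};
  lift_carries : forall t, carries A t (f t) }.

Lemma lift_le A f : is_lift A f -> {homo f : x y / x <= y}.
Proof.
move=> /lift_incr h x y; rewrite !le_eqVlt => /predU1P[->|/h->].
  by rewrite eqxx.
by rewrite orbT.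
Qed.

Lemma is_lift_inj A f : is_lift A f -> injective f.
Proof.
move=> /lift_incr h x y; have [/h|/h|//] := ltgtP x y.
  by move=> + E; rewrite E ltxx.
by move=> + E; rewrite E ltxx.
Qed.

Lemma liftD2piz A f t (m : int) : is_lift A f ->
  f (t + m%:~R * (2 * pi)) = f t + m%:~R * (2 * pi).
Proof.
move=> /liftD2pi fD.
have fDn s n : f (s + n%:R * (2 * pi)) = f s + n%:R * (2 * pi).
  elim: n => [|n IHn]; first by rewrite mul0r !addr0.
  by rewrite -natr1 mulrDl mul1r !addrA fD IHn.
case: m => n; first exact: fDn.
rewrite NegzE mulrNz mulNr -[in RHS](subrK (n.+1%:R * (2 * pi)) t) fDn addrK.
by [].
Qed.

Lemma is_lift_comp A B f g : is_lift A f -> is_lift B g -> is_lift (A *m B) (f \o g).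
Proof.
move=> [fc fD fi fA] [gc gD gi gB]; split.
- by move=> t; apply: continuous_comp; [exact: gc|exact: fc].
- by move=> t /=; rewrite gD fD.
- by move=> x y /gi/fi.
- by move=> t; apply: carries_mul (gB t).
Qed.

Lemma is_lift_id : is_lift 1%:M id.
Proof.
by split=> // t; [exact: cvg_id|exists 1 => //; rewrite mul1mx scale1r].
Qed.

Lemma is_liftD2pi A f : is_lift A f -> is_lift (- A) (fun t => f t + 2 * pi).
Proof.
move=> [fc fD fi fA]; split.
- by move=> t; apply: cvgD; [exact: fc|exact: cvg_cst].
- by move=> t; rewrite fD.
- by move=> x y /fi; rewrite ltrD2r.
- by move=> t; exact: carriesN.
Qed.

Lemma is_liftB2pi A f : is_lift A f -> is_lift (- A) (fun t => f t - 2 * pi).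
Proof.
move=> [fc fD fi fA]; split.
- by move=> t; apply: cvgD; [exact: fc|exact: cvg_cst].
- by move=> t; rewrite fD; lra.
- by move=> x y /fi; rewrite ltrD2r.
- move=> t; have [r r0 E] := fA t; exists r => //.
  by rewrite mulNmx E -[in LHS](subrK (2 * pi) (f t)) RP1_coverD2pi scalerN opprK.
Qed.

Lemma is_lift_shift A f (m : int) : is_lift A f ->
  exists2 B, (B = A \/ B = - A) & is_lift B (fun t => f t + m%:~R * (2 * pi)).
Proof.
move=> fA; elim/int_rect: m => [|n [B BA fB]|n [B BA fB]].
- by exists A; [left|rewrite (_ : (fun=> _) = f)//; apply/funext => t; rewrite mul0r addr0].
- exists (- B); first by case: BA => ->; rewrite ?opprK; [right|left].
  have := is_liftD2pi fB; congr is_lift; apply/funext => t.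
  by rewrite intS intrD mulrDl mul1r; lra.
- exists (- B); first by case: BA => ->; rewrite ?opprK; [right|left].
  have := is_liftB2pi fB; congr is_lift; apply/funext => t.
  have -> : (- n.+1%:Z)%:~R = (- n%:Z)%:~R - 1 :> R by rewrite intS opprD intrD addrC.
  by lra.
Qed.

(** Lifts of the same matrix differ by multiples of [4 * pi]. *)
Lemma is_lift_eq A f g : is_lift A f -> is_lift A g ->
  (forall t, `|f t - g t| < 4 * pi) -> f = g.
Proof.
move=> fA gA fg; apply/funext => t; have pi0 := pi_gt0 R.
have [m mE] := carries_uniq (lift_carries fA t) (lift_carries gA t).
have m0 : m = 0.
  apply: (@intmul_small_eq0 R m (4 * pi)); first by lra.
  by have := fg t; rewrite mE [X in `|X|]addrAC subrr add0r.
by rewrite mE m0 mul0r addr0.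
Qed.

(** By the intermediate value theorem on one period. *)
Lemma lift_surj A f s : is_lift A f -> exists t, f t = s.
Proof.
move=> fA; have pi0 := pi_gt0 R; have fc := lift_continuous fA.
have [m m1 m2] := floor_2pi (s - f 0).
have [||| c _ fcE] := @IVT R f (m%:~R * (2 * pi)) (m%:~R * (2 * pi) + 2 * pi) s.
- by lra.
- exact: continuous_subspaceT.
- have E := liftD2piz 0 m fA; rewrite !add0r in E *.
  have E2 := liftD2pi fA (m%:~R * (2 * pi)); rewrite E2 E.
  by rewrite min_l ?max_r; lra.
by exists c.
Qed.

End Lifts.

(** * Matrices that move the boundary backwards, and their canonical lifts *)
Section Backward.
Variable R : realType.
Implicit Types (A B : 'M[R]_2) (t x y : R) (f g : R -> R).

(** For a matrix of determinant 1, these closed conditions on the entries mean that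
the form [quad] below is nonnegative, and hence that A has a lift f with
[t - 2 * pi <= f t <= t]. *)
Definition backward A := [&& 0 <= A 1 0, A 0 1 <= 0 & `|\tr A| <= 2].

(** The determinant of the pair (v, A v) for the vector v of coordinates x and y. *)
Definition quad A x y : R :=
  A 1 0 * x ^+ 2 + (A 1 1 - A 0 0) * x * y - A 0 1 * y ^+ 2.

Lemma backward_tr2 A : backward A -> (A 0 0 + A 1 1) ^+ 2 <= 4.
Proof.
move=> /and3P[_ _]; rewrite tr22 => tA.
have -> : 4 = 2 ^+ 2 :> R by ring.
rewrite -[leLHS]ger0_norm ?sqr_ge0// normrX ler_sqr ?nnegrE//.
Qed.

(** Completing the square leaves the coefficient [4 - (\tr A) ^+ 2]. *)
Lemma backward_quad A x y : \det A = 1 -> backward A -> 0 <= quad A x y.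
Proof.
rewrite /quad det22 => dA bA; have := backward_tr2 bA; case/and3P: bA => c0 b0 _.
move: (A 0 0) (A 0 1) (A 1 0) (A 1 1) dA c0 b0 => a b c d dA c0 b0 tr.
have [c00|cn0] := eqVneq c 0.
  have ad : (d - a) ^+ 2 <= 0.
    have -> : (d - a) ^+ 2 = (a + d) ^+ 2 - 4 * (a * d - b * c) by rewrite c00; ring.
    by rewrite dA; lra.
  have -> : d - a = 0 by apply/eqP; rewrite -sqrf_eq0 eq_le ad sqr_ge0.
  rewrite c00 !mul0r !add0r -mulNr mulr_ge0 ?sqr_ge0//; lra.
have cp : 0 < c by rewrite lt_def cn0.
rewrite -(pmulr_rge0 _ cp) -(pmulr_rge0 _ (_ : 0 < 4)) //.
have -> : 4 * (c * (c * x ^+ 2 + (d - a) * x * y - b * y ^+ 2)) =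
   (2 * c * x + (d - a) * y) ^+ 2 + (4 * (a * d - b * c) - (a + d) ^+ 2) * y ^+ 2 by ring.
rewrite dA addr_ge0 ?sqr_ge0// mulr_ge0 ?sqr_ge0//; lra.
Qed.

Lemma quad_backward A :
  \det A = 1 -> (forall x y, 0 <= quad A x y) -> backward A.
Proof.
rewrite /quad /backward tr22 det22.
move: (A 0 0) (A 0 1) (A 1 0) (A 1 1) => a b c d dA q.
have c0 : 0 <= c by have := q 1 0; rewrite expr1n expr0n/= !mulr0 !mulr1 addr0 subr0.
have b0 : b <= 0 by have := q 0 1; rewrite expr1n expr0n/= !(mulr0, mulr1, addr0, add0r); lra.
rewrite c0 b0/= -ler_sqr ?nnegrE// -normrX ger0_norm ?sqr_ge0//.
have [c00|cn0] := eqVneq c 0.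
  suff ad : a = d.
    have -> : (a + d) ^+ 2 = 4 * (a * d - b * c) by rewrite c00 ad; ring.
    by rewrite dA mulr1 expr2; lra.
  have [//|ad] := eqVneq a d.
  have da : d - a != 0 by rewrite subr_eq0 eq_sym.
  have := q ((b - 1) / (d - a)) 1.
  rewrite c00 mul0r add0r mulr1 expr1n mulr1 [_ * (_ / _)]mulrCA divff// mulr1; lra.
have cp : 0 < c by rewrite lt_def cn0.
have := q (- (d - a)) (2 * c).
have -> : c * (- (d - a)) ^+ 2 + (d - a) * - (d - a) * (2 * c) - b * (2 * c) ^+ 2 =
  c * (4 * (a * d - b * c) - (a + d) ^+ 2) by ring.
by rewrite (pmulr_rge0 _ cp) dA; lra.
Qed.

(** At the vector of angle t / 2, [quad A] is a positive multiple of the sine of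
[(t - f t) / 2]. *)
Lemma carries_backward A (f : R -> R) : \det A = 1 -> (forall t, carries A t (f t)) ->
  (forall t, t - 2 * pi <= f t <= t) -> backward A.
Proof.
move=> dA fA fid; apply: quad_backward => // x y.
have [/orP xy0|] := boolP ((x != 0) || (y != 0)); last first.
  rewrite negb_or !negbK => /andP[/eqP-> /eqP->].
  by rewrite /quad expr0n/= !mulr0 addr0 subr0.
have [t [r r0 [-> ->]]] := polar (introT orP xy0).
have /carriesP[s s0 [E1 E2]] := fA t.
have -> : quad A (r * sin (t / 2)) (r * cos (t / 2)) =
  r ^+ 2 * (sin (t / 2) * (A 1 0 * sin (t / 2) + A 1 1 * cos (t / 2)) -
   cos (t / 2) * (A 0 0 * sin (t / 2) + A 0 1 * cos (t / 2))) by rewrite /quad; ring.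
rewrite E1 E2; have -> : sin (t / 2) * (s * cos (f t / 2)) -
   cos (t / 2) * (s * sin (f t / 2)) = s * sin (t / 2 - f t / 2).
  by rewrite sinB; ring.
rewrite mulr_ge0 ?sqr_ge0// mulr_ge0 ?(ltW s0)// sin_ge0_pi//.
by have /andP[] := fid t; move=> *; apply/andP; split; lra.
Qed.

(** The coordinates of the image of the vector of angle t / 2, in the direct frame
that starts with this vector. *)
Definition along A t :=
  (A 0 0 * sin (t / 2) + A 0 1 * cos (t / 2)) * sin (t / 2) +
  (A 1 0 * sin (t / 2) + A 1 1 * cos (t / 2)) * cos (t / 2).
Definition across A t :=
  (A 0 0 * sin (t / 2) + A 0 1 * cos (t / 2)) * cos (t / 2) -
  (A 1 0 * sin (t / 2) + A 1 1 * cos (t / 2)) * sin (t / 2).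
(** For a backward A, [across A t] is nonpositive, so half of the displacement of t
is an angle in [-pi, 0].  Adding [pi / 2] brings it to [-pi / 2, pi / 2], where
the half-angle formula has a denominator that does not vanish.  The same formula
thus serves all backward matrices, including 1 and - 1, and it is continuous in
the matrix. *)
Definition back_angle A t :=
  atan (along A t / (Num.sqrt (`|across A t| ^+ 2 + along A t ^+ 2) + `|across A t|)).
Definition back_lift A t := t + 4 * back_angle A t - pi.

Lemma along_across_gt0 A t : \det A = 1 ->
  0 < Num.sqrt (`|across A t| ^+ 2 + along A t ^+ 2) + `|across A t|.
Proof.
rewrite det22 => dA; rewrite lt_def addr_ge0 ?sqrtr_ge0// andbT.
apply/eqP => /eqP; rewrite paddr_eq0 ?sqrtr_ge0// => /andP[+ /eqP w0].
rewrite w0 expr0n add0r sqrtr_sqr normr_eq0 => /eqP p0.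
move/eqP: w0; rewrite normr_eq0 => /eqP.
move: p0; rewrite /along /across; have := cos2Dsin2 (t / 2).
set s := sin _; set c := cos _ => cs p0 w0.
have X0 : A 0 0 * s + A 0 1 * c = 0.
  rewrite -[LHS]mulr1 -cs.
  transitivity (s * 0 + c * 0 : R); last by rewrite !mulr0 addr0.
  by rewrite -{1}p0 -w0; ring.
have Y0 : A 1 0 * s + A 1 1 * c = 0.
  rewrite -[LHS]mulr1 -cs.
  transitivity (c * 0 - s * 0 : R); last by rewrite !mulr0 subr0.
  by rewrite -{1}p0 -w0; ring.
have s0 : s = 0.
  rewrite -[s]mul1r -dA; transitivity (A 1 1 * 0 - A 0 1 * 0 : R); last by rewrite !mulr0 subr0.
  by rewrite -{1}X0 -Y0; ring.
have c0 : c = 0.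
  rewrite -[c]mul1r -dA; transitivity (A 0 0 * 0 - A 1 0 * 0 : R); last by rewrite !mulr0 subr0.
  by rewrite -{1}Y0 -X0; ring.
by move/eqP: cs; rewrite s0 c0 !expr0n addr0 eq_sym oner_eq0.
Qed.

(** The argument of [atan] lies in [-1, 1]. *)
Lemma back_lift_itv A t : \det A = 1 -> t - 2 * pi <= back_lift A t <= t.
Proof.
move=> dA; have d0 := along_across_gt0 t dA.
set T := along A t / (Num.sqrt (`|across A t| ^+ 2 + along A t ^+ 2) + `|across A t|).
have T1 : `|T| <= 1.
  rewrite normrM normfV (gtr0_norm d0) ler_pdivrMr// mul1r.
  rewrite ler_wpDr// -sqrtr_sqr ler_wsqrtr// lerDr sqr_ge0 //.
have h1 : atan T <= pi / 4 by rewrite -atan1; apply: le_atan; case/ler_normlP: T1.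
have h2 : - (pi / 4) <= atan T.
  by rewrite -atan1 -atanN; apply: le_atan; case/ler_normlP: T1; lra.
by apply/andP; split; rewrite /back_lift /back_angle -/T; lra.
Qed.

Lemma across_le0 A t : \det A = 1 -> backward A -> across A t <= 0.
Proof.
move=> dA bA; have := backward_quad (sin (t / 2)) (cos (t / 2)) dA bA.
rewrite /quad /across; lra.
Qed.

Lemma back_lift_carries A t : \det A = 1 -> backward A -> carries A t (back_lift A t).
Proof.
move=> dA bA; have d0 := along_across_gt0 t dA.
have [] := polar_atan d0; rewrite -/(back_angle A t).
have := across_le0 t dA bA => /ler0_norm wN; rewrite {2}wN.
set r := Num.sqrt _; set phi := back_angle A t *+ 2 => Ec Es.
apply/carriesP; exists r.
  rewrite lt_def sqrtr_ge0 andbT; apply/eqP => r0.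
  move: d0; rewrite -/r r0; move: Ec; rewrite r0 mul0r => /esym/eqP.
  by rewrite oppr_eq0 => /eqP->; rewrite normr0 addr0 ltxx.
have -> : back_lift A t / 2 = t / 2 + (phi - pi / 2).
  by rewrite /back_lift /phi -mulr_natr; lra.
rewrite sinD [cos (t / 2 + _)]cosD sinBpihalf cosBpihalf.
have cs := cos2Dsin2 (t / 2).
have cr : r * cos phi = - across A t by [].
have sr : r * sin phi = along A t by [].
move: cs cr sr; rewrite /along /across; move: (sin (t / 2)) (cos (t / 2)) => s c cs cr sr.
split.
  transitivity (s * (r * sin phi) - c * (r * cos phi)); last ring.
  rewrite cr sr -[LHS]mulr1 -cs; ring.
transitivity (c * (r * sin phi) + s * (r * cos phi)); last ring.
rewrite cr sr -[LHS]mulr1 -cs; ring.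
Qed.

(** Joint continuity in the matrix and the point. *)
Lemma back_lift_cvg (T : Type) (F : set_system T) (FF : Filter F)
    (M : T -> 'M[R]_2) (t : T -> R) (M0 : 'M[R]_2) (t0 : R) :
  (forall i j, M x i j @[x --> F] --> M0 i j) -> t x @[x --> F] --> t0 ->
  \det M0 = 1 -> back_lift (M x) (t x) @[x --> F] --> back_lift M0 t0.
Proof.
move=> cM ct dM.
have t2 : t x / 2 @[x --> F] --> t0 / 2 by apply: cvgM => //; exact: cvg_cst.
have cs : sin (t x / 2) @[x --> F] --> sin (t0 / 2).
  by apply: continuous_cvg t2; exact: continuous_sin.
have cc : cos (t x / 2) @[x --> F] --> cos (t0 / 2).
  by apply: continuous_cvg t2; exact: continuous_cos.
have cX i : M x i 0 * sin (t x / 2) + M x i 1 * cos (t x / 2) @[x --> F] -->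
    M0 i 0 * sin (t0 / 2) + M0 i 1 * cos (t0 / 2).
  by apply: cvgD; apply: cvgM.
have cal : along (M x) (t x) @[x --> F] --> along M0 t0.
  by apply: cvgD; apply: cvgM.
have cac : across (M x) (t x) @[x --> F] --> across M0 t0.
  by apply: cvgB; apply: cvgM.
have cn : `|across (M x) (t x)| @[x --> F] --> `|across M0 t0| by exact: cvg_norm.
apply: cvgB; last exact: cvg_cst.
apply: cvgD => //; apply: cvgM; first exact: cvg_cst.
apply: continuous_cvg; first exact: continuous_atan.
apply: cvgM => //; apply: cvgV; first by rewrite gt_eqF// along_across_gt0.
apply: cvgD => //; apply: continuous_cvg; first exact: sqrt_continuous.
by apply: cvgD; rewrite !expr2; under eq_cvg do rewrite expr2; apply: cvgM.
Qed.

Lemma back_lift_is_lift A : \det A = 1 -> backward A -> is_lift A (back_lift A).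
Proof.
move=> dA bA; have pi0 := pi_gt0 R.
have D2 t : back_lift A (t + 2 * pi) = back_lift A t + 2 * pi.
  rewrite /back_lift /back_angle.
  have E : (t + 2 * pi) / 2 = t / 2 + pi by lra.
  have -> : along A (t + 2 * pi) = along A t by rewrite /along E sinDpi cosDpi; ring.
  have -> : across A (t + 2 * pi) = across A t by rewrite /across E sinDpi cosDpi; ring.
  by lra.
split.
- move=> t; apply: (@back_lift_cvg R (nbhs t) _ (fun=> A) id) => //.
  by move=> i j; exact: cvg_cst.
- exact: D2.
- move=> x y xy.
  have /andP[x1 x2] := back_lift_itv x dA.
  have /andP[y1 y2] := back_lift_itv y dA.
  have [yx|yx|->] := ltgtP y (x + 2 * pi); last by rewrite D2; lra.
  + have [r r0 E] := carries_det dA (back_lift_carries x dA bA) (back_lift_carries y dA bA).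
    have /andP[] : 0 < (back_lift A y - back_lift A x) / 2 < pi; last by lra.
    apply: sin_gt0_itv; first by apply/andP; split; lra.
    rewrite -(pmulr_rgt0 _ r0) -E.
    by apply: (@sin_gt0_pi R); apply/andP; split; lra.
  + by lra.
- by move=> t; exact: back_lift_carries.
Qed.

End Backward.

(** * Existence and uniqueness of lifts *)
Section Existence.
Variable R : realType.
Implicit Types (A B : 'M[R]_2) (t x y : R) (f g : R -> R).

Definition mx22 (a b c d : R) : 'M[R]_2 :=
  \matrix_(i, j) if i == 0 then (if j == 0 then a else b) else (if j == 0 then c else d).

Lemma mx22E a b c d : ((mx22 a b c d 0 0 = a) * (mx22 a b c d 0 1 = b) *
  (mx22 a b c d 1 0 = c) * (mx22 a b c d 1 1 = d))%type.
Proof. by rewrite !mxE. Qed.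

Lemma mx22P A B : A 0 0 = B 0 0 -> A 0 1 = B 0 1 -> A 1 0 = B 1 0 ->
  A 1 1 = B 1 1 -> A = B.
Proof.
by move=> E00 E01 E10 E11; apply/matrixP; apply: ord2P; apply: ord2P.
Qed.

Lemma det22N A : \det (- A) = \det A.
Proof. by rewrite !det22 !mxE !mulrNN. Qed.

(** After a change of sign, a rotation of entries x and y makes A symmetric with
positive diagonal (polar decomposition).  The quarter-turn J has [J^2 = -1], and J
times a symmetric matrix with positive diagonal is backward; rotations, up to
sign, are backward too.  So A is a product of three backward matrices. *)
Lemma lift_exists A : \det A = 1 -> exists f, is_lift A f.
Proof.
move=> dA.
suff H B : \det B = 1 -> 0 <= B 0 1 - B 1 0 -> exists f, is_lift B f.
  have [bc|bc] := leP 0 (A 0 1 - A 1 0); first exact: H.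
  have [||f fA] := H (- A); first by rewrite det22N.
    by rewrite !mxE; lra.
  by exists (fun t => f t + 2 * pi); rewrite -[A]opprK; exact: is_liftD2pi.
rewrite det22; move=> {A}dA bc.
have dB : \det B = 1 by rewrite det22.
move: (mx22P (A := mx22 (B 0 0) (B 0 1) (B 1 0) (B 1 1)) (B := B)).
rewrite !mx22E => /(_ erefl erefl erefl erefl) <-.
move: (B 0 0) (B 0 1) (B 1 0) (B 1 1) dA bc => a b c d dA bc {dB}.
set n2 := (a + d) ^+ 2 + (b - c) ^+ 2.
have n20 : 0 < n2.
  have -> : n2 = a ^+ 2 + b ^+ 2 + c ^+ 2 + d ^+ 2 + 2 * (a * d - b * c) by rewrite /n2; ring.
  by rewrite dA; have := (sqr_ge0 a, sqr_ge0 b, sqr_ge0 c, sqr_ge0 d) => -[[[]]]; lra.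
set s := Num.sqrt n2; have s0 : 0 < s by rewrite sqrtr_gt0.
have s2 : s ^+ 2 = n2 by rewrite sqr_sqrtr// ltW.
pose x := (a + d) / s; pose y := (b - c) / s.
have sx : s * x = a + d by rewrite mulrC divfK// gt_eqF.
have sy : s * y = b - c by rewrite mulrC divfK// gt_eqF.
have xy1 : x ^+ 2 + y ^+ 2 = 1.
  apply: (mulfI (_ : s ^+ 2 != 0)); first by rewrite expf_neq0// gt_eqF.
  by rewrite mulrDr -!exprMn sx sy mulr1 s2.
have y0 : 0 <= y by rewrite divr_ge0// ltW.
have x1 : `|x| <= 1.
  by rewrite -ler_sqr ?nnegrE// -normrX ger0_norm ?sqr_ge0// expr1n -xy1 lerDl sqr_ge0.
pose N1 := mx22 (- x) (- y) y (- x).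
pose J := mx22 0 (- 1) 1 0.
pose N3 := mx22 (- (y * a + x * c)) (- (y * b + x * d)) (x * a - y * c) (x * b - y * d).
have d1 : \det N1 = 1 by rewrite det22 !mx22E -xy1; ring.
have dJ : \det J = 1 by rewrite det22 !mx22E; ring.
have d3 : \det N3 = 1.
  rewrite det22 !mx22E.
  transitivity ((x ^+ 2 + y ^+ 2) * (a * d - b * c)); first ring.
  by rewrite xy1 dA mulr1.
have b1 : backward N1.
  rewrite /backward tr22 !mx22E y0 oppr_le0 y0/=.
  have -> : - x - x = - (2 * x) by ring.
  by rewrite normrN normrM ger0_norm// ler_piMr.
have bJ : backward J.
  by rewrite /backward tr22 !mx22E ler01 oppr_le0 ler01/= addr0 normr0.
have b3 : backward N3.
  rewrite /backward tr22 !mx22E; apply/and3P; split.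
  - rewrite -(pmulr_rge0 _ s0) (_ : s * _ = (s * x) * a - (s * y) * c); last ring.
    rewrite sx sy.
    have -> : (a + d) * a - (b - c) * c = a ^+ 2 + c ^+ 2 + (a * d - b * c) by ring.
    by rewrite dA !addr_ge0 ?sqr_ge0.
  - rewrite oppr_le0 -(pmulr_rge0 _ s0) (_ : s * _ = (s * y) * b + (s * x) * d); last ring.
    rewrite sx sy.
    have -> : (b - c) * b + (a + d) * d = b ^+ 2 + d ^+ 2 + (a * d - b * c) by ring.
    by rewrite dA !addr_ge0 ?sqr_ge0.
  - suff -> : - (y * a + x * c) + (x * b - y * d) = 0 by rewrite normr0.
    apply: (mulfI (lt0r_neq0 s0)); rewrite mulr0.
    transitivity ((s * x) * (b - c) - (s * y) * (a + d)); first ring.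
    by rewrite sx sy; ring.
have -> : mx22 a b c d = (N1 *m J) *m N3.
  have E z : z = (x ^+ 2 + y ^+ 2) * z by rewrite xy1 mul1r.
  by apply: mx22P; rewrite !mul22 !mx22E [LHS]E; ring.
exists ((back_lift N1 \o back_lift J) \o back_lift N3).
by apply: is_lift_comp; [apply: is_lift_comp|]; exact: back_lift_is_lift.
Qed.

Lemma lattice_valued_const (f : R -> R) (c : R) : 0 < c -> continuous f ->
  (forall t, exists m : int, f t = m%:~R * c) -> forall t, f t = f 0.
Proof.
move=> c0 fc fm t; apply/eqP; case: (eqVneq (f t) (f 0)) => // ne.
have [m0 E0] := fm 0; have [m1 E1] := fm t.
have mn : m1 != m0 by apply: contra_neq ne => e; rewrite E0 E1 e.
have bad x (m : int) : f x = m%:~R * c + c / 2 -> False.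
  have [k ->] := fm x => E.
  have : (2 * (k - m))%:~R = 1%:~R :> R.
    apply: (mulIf (lt0r_neq0 c0)); rewrite intrM intrB; lra.
  by move/eqP; rewrite eqr_int => /eqP; lia.
pose a := Num.min 0 t; pose b := Num.max 0 t.
have ab : a <= b by rewrite /a /b ge_min !le_max !lexx.
suff [m /(IVT ab (continuous_subspaceT fc))[x _ /bad//]] : exists m : int,
    Num.min (f a) (f b) <= m%:~R * c + c / 2 <= Num.max (f a) (f b).
have key (k l : int) : (k < l)%R -> k%:~R * c <= k%:~R * c + c / 2 <= l%:~R * c.
    move=> kl; apply/andP; split; first by lra.
    have : (k + 1)%:~R * c <= l%:~R * c by rewrite ler_pM2r// ler_int; lia.
    by rewrite intrD mulrDl; lra.
  have [[-> ->]|[-> ->]] : (f a = f 0 /\ f b = f t) \/ (f a = f t /\ f b = f 0).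
    by rewrite /a /b /Num.min /Num.max; case: ltP => _; [left|right].
  - rewrite E0 E1; have [lt|lt|/eqP] := ltgtP m1 m0; last by rewrite (negbTE mn).
    + exists m1; have /andP[h1 h2] := key _ _ lt.
      by rewrite min_r ?max_l ?h1 ?h2//; lra.
    + exists m0; have /andP[h1 h2] := key _ _ lt.
      by rewrite min_l ?max_r ?h1 ?h2//; lra.
  - rewrite E0 E1; have [lt|lt|/eqP] := ltgtP m1 m0; last by rewrite (negbTE mn).
    + exists m1; have /andP[h1 h2] := key _ _ lt.
      by rewrite min_l ?max_r ?h1 ?h2//; lra.
    + exists m0; have /andP[h1 h2] := key _ _ lt.
      by rewrite min_r ?max_l ?h1 ?h2//; lra.
Qed.

(** Unlike in [carries_uniq], the integer does not depend on t. *)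
Lemma is_lift_uniq A f g : is_lift A f -> is_lift A g ->
  exists m : int, forall t, f t = g t + m%:~R * (4 * pi).
Proof.
move=> fA gA; have pi0 := pi_gt0 R; pose d t := f t - g t.
have dm t : exists m : int, d t = m%:~R * (4 * pi).
  have [m E] := carries_uniq (lift_carries fA t) (lift_carries gA t).
  by exists m; rewrite /d E addrC addKr.
have dc : continuous d.
  by move=> t; apply: cvgB; [exact: lift_continuous fA t|exact: lift_continuous gA t].
have [m E] := dm 0; exists m => t.
have p4 : 0 < 4 * pi :> R by lra.
by rewrite -E -(lattice_valued_const p4 dc dm t) /d addrC subrK.
Qed.

Lemma repr_PSL2 (A : SL2 R) : (repr (\pi_(PSL2 R) A) : SL2 R) = A :> 'M[R]_2 \/
  (repr (\pi_(PSL2 R) A) : SL2 R) = - (A : 'M[R]_2) :> 'M[R]_2.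
Proof. by have /orP[/eqP|/eqP] := PSL2_repr_pm A; [left|right]. Qed.

Lemma is_lift_lifts_elt (A : SL2 R) f : is_lift A f -> lifts_elt f (\pi_(PSL2 R) A).
Proof.
move=> fA; split; first exact: lift_continuous fA.
move=> t; have [r r0 E] := lift_carries fA t.
have [->|->] := repr_PSL2 A; first by exists r; rewrite ?gt_eqF.
by exists (- r); rewrite ?oppr_eq0 ?gt_eqF// mulNmx E scaleNr.
Qed.

(** An element of PSL(2,R) only determines its lifts up to multiples of [2 * pi]. *)
Lemma lifts_elt_uniq (A : SL2 R) f g : is_lift A f -> lifts_elt g (\pi_(PSL2 R) A) ->
  exists m : int, forall t, g t = f t + m%:~R * (2 * pi).
Proof.
move=> fA [gc gA]; have pi0 := pi_gt0 R; pose d t := g t - f t.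
have dm t : exists m : int, d t = m%:~R * (2 * pi).
  have [r r0 E] := lift_carries fA t.
  have [s s0 F] := gA t.
  have [q q0 {}F] : exists2 q, q != 0 & A *m RP1_cover t = q *: RP1_cover (g t).
    case: (repr_PSL2 A) F => -> F; first by exists s.
    by exists (- s); rewrite ?oppr_eq0// scaleNr -F mulNmx opprK.
  have F0 := congr1 (fun M : 'cV[R]_2 => M 0 0) F.
  have F1 := congr1 (fun M : 'cV[R]_2 => M 1 0) F.
  move: F0 F1; rewrite E !mxE /= => F0 F1.
  have /sin_eq0[m mE] : sin (g t / 2 - f t / 2) = 0.
    apply: (mulfI q0); rewrite mulr0; apply: (mulfI (lt0r_neq0 r0)); rewrite mulr0.
    rewrite sinB.
    transitivity ((q * sin (g t / 2)) * (r * cos (f t / 2)) -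
     (q * cos (g t / 2)) * (r * sin (f t / 2))); first ring.
    by rewrite -F0 -F1; ring.
  by exists m; rewrite /d; lra.
have dc : continuous d.
  by move=> t; apply: cvgB; [exact: gc|exact: lift_continuous fA t].
have [m E] := dm 0; exists m => t.
have p4 : 0 < 2 * pi :> R by lra.
by rewrite -E -(lattice_valued_const p4 dc dm t) /d addrC subrK.
Qed.

End Existence.

(** * Translation numbers *)
Section TranslationNumber.
Variable R : realType.
Implicit Types (A B : 'M[R]_2) (t x y c : R) (f g : R -> R).

(** For lifts, the orbits stay at bounded distance from an arithmetic progression.
This is stronger than the convergence of [iter k f 0 / k], and stable under
composition with integer translations. *)
Definition has_translation f c : Prop :=
  exists C, forall k, `|iter k f 0 - k%:R * c| <= C.

Lemma has_translationE f c : has_translation f c -> translation_number f = c.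
Proof.
move=> [C fC]; apply: cvg_lim => //.
apply/cvgrPdist_le => e e0; near=> k.
have k0 : 0 < k%:R :> R by rewrite ltr0n; near: k; exact: nbhs_infty_gt.
rewrite subr0 -[c](mulfK (lt0r_neq0 k0)) -mulrBl normrM normfV (gtr0_norm k0).
rewrite ler_pdivrMr// distrC [c * _]mulrC; apply: le_trans (fC k) _.
rewrite -ler_pdivrMl//; near: k; exact: nbhs_infty_ger.
Unshelve. all: by end_near. Qed.

(** Since f is increasing and commutes with the translation by [2 * pi], two orbits
that start within [2 * pi] of each other stay so: any orbit computes the
translation number. *)
Lemma is_lift_orbit A f c (x : nat -> R) C : is_lift A f ->
  (forall k, x k.+1 = f (x k)) -> (forall k, `|x k - k%:R * c| <= C) ->
  has_translation f c.
Proof.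
move=> fA xS xC; have pi0 := pi_gt0 R.
have [m m1 m2] := floor_2pi (x 0%N).
have itD k : iter k f 0 <= x k - m%:~R * (2 * pi) <= iter k f 0 + 2 * pi.
  elim: k => [|k /andP[IH1 IH2]]; first by apply/andP; split => /=; lra.
  rewrite /= xS -[x k in X in _ <= X <= _](subrK (m%:~R * (2 * pi))).
  rewrite (liftD2piz _ _ fA) addrK -(liftD2pi fA).
  by rewrite !(lift_le fA).
exists (C + `|m%:~R * (2 * pi)| + 2 * pi) => k.
have /andP[h1 h2] := itD k; have := xC k.
have := lexx `|m%:~R * (2 * pi) : R|; rewrite {1}ler_norml.
move: (m%:~R * (2 * pi)) h1 h2 => M h1 h2 /andP[h3 h4].
by rewrite !ler_norml => /andP[h5 h6]; apply/andP; split; lra.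
Qed.

Lemma fixed_translation A f t (m : int) : is_lift A f ->
  f t = t + m%:~R * (2 * pi) -> has_translation f (m%:~R * (2 * pi)).
Proof.
move=> fA ft; apply: (is_lift_orbit (x := fun k => t + k%:R * (m%:~R * (2 * pi)))
    (C := `|t|) fA).
  move=> k; have -> : k%:R * (m%:~R * (2 * pi)) = (k%:Z * m)%:~R * (2 * pi) :> R.
    by rewrite intrM mulrA.
  rewrite (liftD2piz _ _ fA) ft -natr1 intrM -pmulrn; ring.
by move=> k; rewrite addrK.
Qed.

Lemma has_translation_shift A f c (m : int) : is_lift A f -> has_translation f c ->
  has_translation (fun t => f t + m%:~R * (2 * pi)) (c + m%:~R * (2 * pi)).
Proof.
move=> fA [C fC]; exists C => k.
suff -> : iter k (fun t => f t + m%:~R * (2 * pi)) 0 =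
    iter k f 0 + (k%:Z * m)%:~R * (2 * pi).
  rewrite intrM -pmulrn; apply: le_trans (fC k).
  by rewrite le_eqVlt; apply/orP; left; apply/eqP; congr `|_|; ring.
elim: k => [|k IH]; first by rewrite /= mul0r mul0r addr0.
rewrite iterS IH (liftD2piz _ _ fA) iterS.
have -> : (k.+1%:Z * m)%:~R = (k%:Z * m)%:~R + m%:~R :> R.
  by rewrite intS mulrDl mul1r intrD addrC.
by ring.
Qed.

Lemma natmul_bounded_le0 x C : (forall k : nat, k%:R * x <= C) -> x <= 0.
Proof.
move=> kx; rewrite leNgt; apply/negP => x0.
have := kx (Num.bound `|C / x|); rewrite leNgt => /negP; apply.
rewrite -ltr_pdivrMr//; apply: le_lt_trans (ler_norm _) _.
exact/archi_boundP/normr_ge0.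
Qed.

Lemma has_translation_itv A f c : is_lift A f -> has_translation f c ->
  (forall t, t - 2 * pi <= f t <= t) -> - (2 * pi) <= c <= 0.
Proof.
move=> fA [C fC] fid.
have it k : k%:R * - (2 * pi) <= iter k f 0 <= 0.
  elim: k => [|k /andP[h1 h2]]; first by rewrite mul0r/= lexx.
  have /andP[h3 h4] := fid (iter k f 0).
  by rewrite iterS -natr1 mulrDl mul1r; apply/andP; split; lra.
apply/andP; split.
  rewrite -subr_le0; apply: (@natmul_bounded_le0 _ C) => k.
  have := fC k; have /andP[h1 h2] := it k; rewrite ler_norml => /andP[h3 h4].
  by rewrite mulrBr; lra.
apply: (@natmul_bounded_le0 _ C) => k.
have := fC k; have /andP[h1 h2] := it k; rewrite ler_norml => /andP[h3 h4].
by lra.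
Qed.

Lemma lift_displacement A f : is_lift A f ->
  exists C, forall t, `|f t - t| <= C.
Proof.
move=> fA; have pi0 := pi_gt0 R; exists (`|f 0| + 2 * pi) => t.
have [m m1 m2] := floor_2pi t.
have h1 : f 0 + m%:~R * (2 * pi) <= f t.
  by rewrite -(liftD2piz _ _ fA) add0r (lift_le fA).
have h2 : f t <= f 0 + m%:~R * (2 * pi) + 2 * pi.
  by rewrite -(liftD2piz _ _ fA) -(liftD2pi fA) add0r (lift_le fA)// ltW.
have := lexx `|f 0|; rewrite {1}ler_norml.
by move=> /andP[h3 h4]; rewrite ler_norml; apply/andP; split; lra.
Qed.

(** Between two consecutive translates of t, f is at most its value at the right
one, which is the left one. *)
Lemma lift_le_id A f t : is_lift A f -> f t = t - 2 * pi -> forall s, f s <= s.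
Proof.
move=> fA ft s; have pi0 := pi_gt0 R.
have [m m1 m2] := floor_2pi (s - t).
have : f s <= f (t + m%:~R * (2 * pi) + 2 * pi) by rewrite (lift_le fA)//; lra.
by rewrite (liftD2pi fA) (liftD2piz _ _ fA) ft; lra.
Qed.

End TranslationNumber.

(** * Fixed points on the boundary and in the half-plane *)
Section Eigen.
Variable R : realType.
Implicit Types (A : 'M[R]_2) (l t : R).

Lemma eigendirection A l : \det A = 1 -> l ^+ 2 - \tr A * l + 1 = 0 ->
  exists t, A *m RP1_cover t = l *: RP1_cover t.
Proof.
rewrite det22 tr22 => dA lE.
suff [x [y [xy0 [E0 E1]]]] : exists x y, [/\ (x != 0) || (y != 0),
    A 0 0 * x + A 0 1 * y = l * x & A 1 0 * x + A 1 1 * y = l * y].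
  have [t [r r0 [xE yE]]] := polar xy0; exists t.
  have rn : r != 0 by rewrite gt_eqF.
  apply/matrixP => i j; rewrite ord1 {j} mul22 !mxE /=; apply: (mulfI rn).
  move: i; apply: ord2P => /=.
    transitivity (A 0 0 * (r * sin (t / 2)) + A 0 1 * (r * cos (t / 2))); first ring.
    by rewrite -xE -yE E0 xE; ring.
  transitivity (A 1 0 * (r * sin (t / 2)) + A 1 1 * (r * cos (t / 2))); first ring.
  by rewrite -xE -yE E1 yE; ring.
move: (A 0 0) (A 0 1) (A 1 0) (A 1 1) dA lE => a b c d dA lE.
have [n0|] := boolP ((b != 0) || (l - a != 0)).
  exists b, (l - a); split => //; first ring.
  by apply/eqP; rewrite -subr_eq0 -oppr_eq0 -lE -dA; apply/eqP; ring.
rewrite negb_or !negbK => /andP[/eqP b0 /eqP la].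
have [n1|] := boolP ((l - d != 0) || (c != 0)).
  exists (l - d), c; split => //; last ring.
  by apply/eqP; rewrite -subr_eq0 -oppr_eq0 -lE -dA; apply/eqP; ring.
rewrite negb_or !negbK => /andP[_ /eqP c0].
have -> : a = l by lra.
by exists 1, 0; split; rewrite ?oner_eq0// ?c0; ring.
Qed.

End Eigen.

Section RotationAngle.
Variable R : realType.
Implicit Types (A H : SL2 R).

Fact SL2_opp_subproof A : \det (- (A : 'M[R]_2)) == 1.
Proof. by rewrite det22N SL2_det. Qed.
Definition SL2_opp A := MkSL2 (SL2_opp_subproof A).

Lemma pi_SL2_opp A : \pi_(PSL2 R) (SL2_opp A) = \pi_(PSL2 R) A.
Proof. by apply/PSL2_eqP; rewrite /SL2_pm /= eqxx orbT. Qed.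

Lemma norm_tr_repr A : `|\tr (repr (\pi_(PSL2 R) A) : SL2 R)| = `|\tr A|.
Proof. by case: (repr_PSL2 A) => ->//; rewrite linearN normrN. Qed.

Lemma mobiusN (A : 'M[R]_2) z : mobius (- A) z = mobius A z.
Proof.
rewrite /mobius !mxE !rmorphN !mulNr -!opprD invrN mulrNN.
by [].
Qed.

Lemma mobius_derivN (A : 'M[R]_2) z : mobius_deriv (- A) z = mobius_deriv A z.
Proof. by rewrite /mobius_deriv !mxE !rmorphN !mulNr -!opprD sqrrN. Qed.

(** The fixed point equation is quadratic; its imaginary part gives x, and then its
real part gives y. *)
Lemma mobius_fixed (A : 'M[R]_2) (x y : R) : 0 < y -> \det A = 1 -> 0 < A 1 0 ->
  mobius A (x +i* y)%C = (x +i* y)%C <->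
  (x = (A 0 0 - A 1 1) / (2 * A 1 0) /\ (A 1 0 * y) ^+ 2 = 1 - ((A 0 0 + A 1 1) / 2) ^+ 2).
Proof.
rewrite det22 /mobius; move: (A 0 0) (A 0 1) (A 1 0) (A 1 1) => a b c d y0 dA c0.
have cn := lt0r_neq0 c0; have yn := lt0r_neq0 y0.
have wn : ((c%:C * (x +i* y) + d%:C) != 0)%C.
  by rewrite eq_complex /= !(mul0r, subr0, addr0, add0r) negb_and mulf_neq0 ?orbT.
apply: (@iff_trans _ ((a%:C * (x +i* y) + b%:C) = (x +i* y) * (c%:C * (x +i* y) + d%:C))%C).
  split=> [/(congr1 ( *%R^~ (c%:C * (x +i* y) + d%:C)%C))|->]; first by rewrite divfK.
  by rewrite mulfK.
apply: (@iff_trans _ (a * x + b = x * (c * x + d) - y * (c * y) /\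
    a * y = x * (c * y) + y * (c * x + d))).
  split=> [/eqP|[E1 E2]].
    rewrite eq_complex /= !(mul0r, subr0, addr0, add0r).
    by move=> /andP[/eqP E1 /eqP E2].
  by apply/eqP; rewrite eq_complex /= !(mul0r, subr0, addr0, add0r) E1 E2 !eqxx.
have key : 2 * c * x = a - d ->
    (a * x + b = x * (c * x + d) - y * (c * y) <-> (c * y) ^+ 2 = 1 - ((a + d) / 2) ^+ 2).
  move=> xE; have -> : 1 - ((a + d) / 2) ^+ 2 = ((2 * c * x) / 2) ^+ 2 +
      (d - a) * (2 * c * x) / 2 - b * c by rewrite xE (_ : b * c = a * d - 1); [field|lra].
  split=> [/(congr1 ( *%R^~ c)) E|E]; first by lra.
  by apply: (mulIf cn); lra.
split=> -[E1 E2].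
  have xE : 2 * c * x = a - d by apply: (mulIf yn); lra.
  split; first by rewrite -xE mulrC mulKf// mulf_neq0// pnatr_eq0.
  exact/key.
have xE : 2 * c * x = a - d by rewrite E1 mulrC divfK// mulf_neq0.
split; first exact/key.
by transitivity ((2 * c * x + d) * y); [rewrite xE subrK|ring].
Qed.

Lemma mobius_derivE (A : 'M[R]_2) (x y b : R) :
  A 1 0 * x + A 1 1 = cos b -> A 1 0 * y = sin b ->
  mobius_deriv A (x +i* y)%C = (cos (2 * pi - 2 * b) +i* sin (2 * pi - 2 * b))%C.
Proof.
rewrite /mobius_deriv => E1 E2.
have -> : ((A 1 0)%:C * (x +i* y) + (A 1 1)%:C = cos b +i* sin b)%C.
  by apply/eqP; rewrite eq_complex /= !(mul0r, subr0, addr0, add0r) E1 E2 !eqxx.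
have -> : cos (2 * pi - 2 * b) = cos b ^+ 2 - sin b ^+ 2.
  rewrite cosB !(mulrC 2) !mulr_natr cos2pi sin2pi mul1r mul0r addr0.
  by rewrite !mulr2n cosD -!expr2.
have -> : sin (2 * pi - 2 * b) = - (2 * sin b * cos b).
  rewrite sinB !(mulrC 2) !mulr_natr cos2pi sin2pi mul1r mul0r sub0r.
  by rewrite [b *+ 2]mulr2n sinD; ring.
set w := (_ +i* _)%C; set v := (_ +i* _)%C.
have wv : w ^+ 2 * v = 1.
  apply/eqP; rewrite expr2 /w /v eq_complex /=; apply/andP; split; apply/eqP.
    transitivity ((cos b ^+ 2 + sin b ^+ 2) ^+ 2); first ring.
    by rewrite cos2Dsin2 expr1n.
  by ring.
have w0 : w ^+ 2 != 0.
  by apply/eqP => w0; move/eqP: wv; rewrite w0 mul0r eq_sym oner_eq0.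
by rewrite -[LHS]mulr1 -wv mulKf.
Qed.

(** At the fixed point z the denominator of the homography is [cos b + i sin b], and
the differential is its power [-2]. *)
Lemma rotation_angleE A (b : R) : 0 < A 1 0 -> 0 < b < pi ->
  A 0 0 + A 1 1 = 2 * cos b -> rotation_angle (\pi_(PSL2 R) A) = 2 * pi - 2 * b.
Proof.
move=> c0 b0 trA; have sb : 0 < sin b by exact: sin_gt0_pi.
have cn := lt0r_neq0 c0; have dA := SL2_det A; have /andP[b1 b2] := b0.
have -> : rotation_angle (\pi_(PSL2 R) A) = xget 0 [set t | 0 < t < 2 * pi /\
    exists z : R[i], [/\ 0 < complex.Im z, mobius A z = z &
      mobius_deriv A z = (cos t +i* sin t)%C]].
  by case: (repr_PSL2 A) => E; rewrite /rotation_angle E//;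
    congr (xget 0 _); apply/seteqP; split=> t /= [t0 [z [z0 z1 z2]]];
    split=> //; exists z; move: z1 z2; rewrite mobiusN mobius_derivN.
have fixE (x : R) : x = (A 0 0 - A 1 1) / (2 * A 1 0) -> A 1 0 * x + A 1 1 = cos b.
  have -> : A 1 1 = 2 * cos b - A 0 0 by lra.
  move=> ->; have : (A 0 0 - (2 * cos b - A 0 0)) / (2 * A 1 0) * (2 * A 1 0) =
    A 0 0 - (2 * cos b - A 0 0) by rewrite divfK// mulf_neq0.
  by lra.
apply: xget_unique => /=.
  split; first by apply/andP; split; lra.
  exists ((A 0 0 - A 1 1) / (2 * A 1 0) +i* (sin b / A 1 0))%C.
  have y0 : 0 < sin b / A 1 0 by rewrite divr_gt0.
  have yE : A 1 0 * (sin b / A 1 0) = sin b by rewrite mulrC divfK.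
  split => //.
    apply/mobius_fixed => //; split => //; rewrite yE trA.
    by rewrite [2 * _]mulrC mulfK// sin2cos2.
  exact: mobius_derivE (fixE _ erefl) yE.
move=> t [/andP[t1 t2] [[x y] /= [y0 /mobius_fixed [] // xE yE]]].
have {}yE : A 1 0 * y = sin b.
  apply/eqP; rewrite -(eqrXn2 (n := 2))// ?mulr_ge0 ?ltW//; apply/eqP.
  by rewrite yE trA [2 * _]mulrC mulfK// sin2cos2.
rewrite (mobius_derivE (fixE _ xE) yE) => -[ct st].
have /cos_eq1[m mE] : cos (2 * pi - 2 * b - t) = 1.
  by rewrite cosB ct st -!expr2 cos2Dsin2.
have pi0 := pi_gt0 R; have p2 : 0 < 2 * pi :> R by lra.
have m0 : m = 0.
  apply: (@intmul_small_eq0 R m (2 * pi)) => //.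
  by rewrite -mE ltr_norml; apply/andP; split; lra.
by move: mE; rewrite m0 mul0r; lra.
Qed.

End RotationAngle.

(** * Conjugation of parabolics to a translation and of elliptics to a rotation *)
Section ConjugacyModels.
Variable R : realType.
Implicit Types (A H : SL2 R).

(** The conjugate of a translation by a matrix of second row (r, s) is
[1 + (s, - r)^T (r, s)]: the sign of its off-diagonal entries detects positive
parabolics. *)
Lemma tr_conj_translation (K A : 'M[R]_2) : \det K = 1 ->
  K *m A = translation_mx R *m K ->
  [/\ \tr A = 2, A 0 1 = K 1 1 ^+ 2 & A 1 0 = - K 1 0 ^+ 2].
Proof.
move=> dK E.
have E00 : (K *m A) 0 0 = (translation_mx R *m K) 0 0 by rewrite E.
have E01 : (K *m A) 0 1 = (translation_mx R *m K) 0 1 by rewrite E.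
have E10 : (K *m A) 1 0 = (translation_mx R *m K) 1 0 by rewrite E.
have E11 : (K *m A) 1 1 = (translation_mx R *m K) 1 1 by rewrite E.
move: dK E00 E01 E10 E11; rewrite tr22 det22 !mul22 /translation_mx !mxE /=.
rewrite !(mul1r, mul0r, add0r, addr0, mulr1n, mulr0n).
move: (A 0 0) (A 0 1) (A 1 0) (A 1 1) (K 0 0) (K 0 1) (K 1 0) (K 1 1).
move=> a b c d p q r s dK E1 E2 E3 E4.
have X z : z = (p * s - q * r) * z by rewrite dK mul1r.
split.
- rewrite [LHS]X.
  transitivity (s * (p * a + q * c) - q * (r * a + s * c)
    + p * (r * b + s * d) - r * (p * b + q * d)); first ring.
  rewrite E1 E2 E3 E4; transitivity (2 * (p * s - q * r)); first ring.
  by rewrite dK mulr1.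
- rewrite [LHS]X.
  transitivity (s * (p * b + q * d) - q * (r * b + s * d)); first ring.
  by rewrite E2 E4; ring.
- rewrite [LHS]X.
  transitivity (p * (r * a + s * c) - r * (p * a + q * c)); first ring.
  by rewrite E1 E3; ring.
Qed.

Lemma PSL2_conjE (A K : SL2 R) :
  (\pi_(PSL2 R) A ^ \pi_(PSL2 R) K)%g = \pi_(PSL2 R) (A ^ K)%g.
Proof. by rewrite !conjgE -(PSL2_mulE K^-1%g) -(PSL2_mulE A) -PSL2_invE. Qed.

Lemma positive_parabolicP A : positive_parabolic (\pi_(PSL2 R) A) ->
  exists K : 'M[R]_2, exists B : 'M[R]_2, [/\ \det K = 1,
   K *m B = translation_mx R *m K & B = A \/ B = - (A : 'M[R]_2)].
Proof.
move=> [h]; rewrite -(reprK h); set K := repr h.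
rewrite /translation1 PSL2_conjE => /PSL2_eqP; set T := MkSL2 _ => AT.
exists K, (T ^ K)%g; split; first exact: SL2_det.
- have : (K * (T ^ K) = T * K)%g by rewrite -conjgC.
  by move/(congr1 (@SL2_mx R)).
- case/orP: AT => /eqP ->; first by left.
  by right; rewrite opprK.
Qed.

Lemma positive_parabolic_intro A (K : SL2 R) :
  K *m (- (A : 'M[R]_2)) = translation_mx R *m K ->
  positive_parabolic (\pi_(PSL2 R) A).
Proof.
move=> E; exists (\pi_(PSL2 R) K); rewrite /translation1 PSL2_conjE -pi_SL2_opp.
congr (\pi_(PSL2 R) _); set T := MkSL2 _.
have : (K * SL2_opp A = T * K)%g by apply: val_inj.
by move=> /(congr1 (fun X => K^-1 * X)%g); rewrite mulKg conjgE => ->.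
Qed.

(** Here [A - 1] is nilpotent and [quad A] is minus the square of a linear form: its
coefficients, read off from [A 0 1] or from [A 1 0], are the second row of K. *)
Lemma conj_translation_exists (A : 'M[R]_2) : \det A = 1 -> \tr A = 2 ->
  0 <= A 0 1 -> A 1 0 <= 0 -> A != 1%:M ->
  exists2 K : 'M[R]_2, \det K = 1 & K *m A = translation_mx R *m K.
Proof.
rewrite det22 tr22 => dA tA b0 c0 A1.
suff [p [q [r [s [dK E1 E2 E3 E4]]]]] : exists p q r s : R,
    [/\ p * s - q * r = 1, p * A 0 0 + q * A 1 0 = p + r,
        p * A 0 1 + q * A 1 1 = q + s, r * A 0 0 + s * A 1 0 = r
      & r * A 0 1 + s * A 1 1 = s].
  exists (mx22 p q r s); first by rewrite det22 !mx22E.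
  apply: mx22P; rewrite !mul22 !mx22E /translation_mx !mxE /=;
    by rewrite !(mul1r, mul0r, add0r, addr0, mulr1n, mulr0n).
have {A1} : (A 0 1 != 0) || (A 1 0 != 0).
  apply: contraNT A1; rewrite negb_or !negbK => /andP[/eqP b00 /eqP c00].
  have a1 : A 0 0 = 1.
    have : (A 0 0 - 1) ^+ 2 = 0.
      have dE : A 1 1 = 2 - A 0 0 by lra. by move: dA; rewrite b00 dE; lra.
    by move/eqP; rewrite sqrf_eq0 subr_eq0 => /eqP.
  apply/eqP/mx22P; rewrite !mxE //=; lra.
move: (A 0 0) (A 0 1) (A 1 0) (A 1 1) dA tA b0 c0 => a b c d dA tA b0 c0.
have dE : d = 2 - a by lra.
have bc : b * c = - (a - 1) ^+ 2 by move: dA; rewrite dE; lra.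
have [b00|bn] := eqVneq b 0.
  rewrite /= => cn; have cl : c < 0 by rewrite lt_neqAle cn.
  have a1 : a = 1.
    apply/eqP; rewrite -subr_eq0 -sqrf_eq0 -oppr_eq0 -bc b00 mul0r.
    by [].
  pose r := Num.sqrt (- c); have r0 : 0 < r by rewrite sqrtr_gt0; lra.
  have r2 : r ^+ 2 = - c by rewrite sqr_sqrtr//; lra.
  have rr : r^-1 * r = 1 by rewrite mulVf// gt_eqF.
  have cr : r^-1 * c = - r by rewrite -[c]opprK -r2 expr2 mulrN mulKf// gt_eqF.
  exists 0, (- r^-1), r, 0; split; rewrite ?dE ?a1 ?b00; lra.
have bp : 0 < b by rewrite lt_def bn.
move=> _; pose s := Num.sqrt b; have s0 : 0 < s by rewrite sqrtr_gt0.
have sn : s != 0 by rewrite gt_eqF.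
have s2 : s ^+ 2 = b by rewrite sqr_sqrtr.
have cE : c = - (a - 1) ^+ 2 / s ^+ 2 by rewrite s2 -bc mulrAC divff// mul1r.
exists s^-1, 0, ((a - 1) / s), s; split; rewrite ?dE ?cE -?s2; by field.
Qed.

(** The upper triangular K sends i to the fixed point of A, so A is conjugate to the
rotation of angle [- 2 * b].  This yields the translation number up to a multiple
of [4 * pi], and the multiple is 0 because the displacement of [back_lift A] lies
in [-2 pi, 0]. *)
Lemma elliptic_translation (A : SL2 R) (b : R) : backward A -> 0 < A 1 0 -> 0 < b < pi ->
  A 0 0 + A 1 1 = 2 * cos b -> has_translation (back_lift A) (- 2 * b).
Proof.
move=> bA c0 b0 trA; have sb : 0 < sin b by exact: sin_gt0_pi.
have pi0 := pi_gt0 R; have dA := SL2_det A.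
have hA := back_lift_is_lift dA bA.
pose Rb := mx22 (cos b) (- sin b) (sin b) (cos b).
have RbL : is_lift Rb (fun t => t - 2 * b).
  split.
  - by move=> t; apply: cvgB; [exact: cvg_id|exact: cvg_cst].
  - by move=> t; lra.
  - by move=> x y; rewrite ltrD2r.
  - move=> t; apply/carriesP; exists 1 => //; rewrite !mx22E.
    have -> : (t - 2 * b) / 2 = t / 2 - b by lra.
    by rewrite sinB cosB; split; ring.
(* The normalization that gives K determinant 1. *)
pose w := (Num.sqrt (sin b * A 1 0))^-1.
have w2 : w ^+ 2 * (sin b * A 1 0) = 1.
  have p0 : 0 < sin b * A 1 0 by rewrite mulr_gt0.
  by rewrite exprVn sqr_sqrtr ?ltW// mulVf// gt_eqF.
pose K := mx22 (sin b * w) ((A 0 0 - A 1 1) / 2 * w) 0 (A 1 0 * w).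
have dK : \det K = 1 by rewrite det22 !mx22E -w2; ring.
have [k kL] := lift_exists dK.
have KE : (A : 'M[R]_2) *m K = K *m Rb.
  have cE : cos b = (A 0 0 + A 1 1) / 2 by rewrite trA mulrAC divff ?mul1r.
  have sE : sin b ^+ 2 = 1 - cos b ^+ 2 by rewrite sin2cos2.
  move: dA; rewrite det22 => dA.
  apply: mx22P; rewrite !mul22 !mx22E ?cE; try by field.
  have bc : A 0 1 * A 1 0 = A 0 0 * A 1 1 - 1 by lra.
  transitivity (w * (A 0 0 * ((A 0 0 - A 1 1) / 2) + A 0 1 * A 1 0)); first ring.
  rewrite bc; transitivity (w * (- sin b ^+ 2 + (A 0 0 - A 1 1) / 2 * cos b)).
    by rewrite sE cE; field.
  by rewrite cE; field.
have L1 := is_lift_comp hA kL; have L2 := is_lift_comp kL RbL.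
rewrite KE in L1; have [m mE] := is_lift_uniq L1 L2.
have [C kC] := lift_displacement kL.
pose y := - 2 * b + (2 * m)%:~R * (2 * pi).
have yT : has_translation (back_lift A) y.
  apply: (is_lift_orbit (x := fun j => k (j%:R * y)) (C := C) hA) => // j.
  have := mE (j%:R * y) => /= ->.
  have -> : j.+1%:R * y = j%:R * y - 2 * b + (2 * m)%:~R * (2 * pi).
    by rewrite -natr1 /y; ring.
  by rewrite (liftD2piz _ _ kL) intrM; lra.
have /andP[y1 y2] := has_translation_itv hA yT (fun t => back_lift_itv t dA).
suff m0 : m = 0 by move: yT; rewrite /y m0 mulr0 mul0r addr0.
have /andP[b1 b2] := b0; have p4 : 0 < 4 * pi :> R by lra.
have yE : y = - 2 * b + m%:~R * (4 * pi) by rewrite /y intrM; lra.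
apply: (@intmul_small_eq0 R m (4 * pi)) => //.
by rewrite ltr_norml; apply/andP; split; lra.
Qed.

End ConjugacyModels.

(** * The lift of translation number theta - 2 pi *)
Section ThetaTranslation.
Variable R : realType.
Implicit Types (A K : SL2 R) (g : PSL2 R).

Lemma carries_eigen (A : 'M[R]_2) (t l : R) : 0 < l ->
  A *m RP1_cover t = l *: RP1_cover t -> carries A t t.
Proof. by move=> l0 E; exists l. Qed.

Lemma carries_eigenN (A : 'M[R]_2) (t l : R) : 0 < l ->
  A *m RP1_cover t = - l *: RP1_cover t -> carries A t (t - 2 * pi).
Proof.
move=> l0 E; exists l => //; rewrite E -[in LHS](subrK (2 * pi) t) RP1_coverD2pi.
by rewrite scaleNr scalerN opprK.
Qed.

Lemma theta_hyperbolic A : 2 < `|\tr A| -> theta (\pi_(PSL2 R) A) = 0.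
Proof. by move=> tA; rewrite /theta /hyperbolic norm_tr_repr tA. Qed.

Lemma theta_elliptic A : `|\tr A| < 2 ->
  theta (\pi_(PSL2 R) A) = rotation_angle (\pi_(PSL2 R) A).
Proof.
move=> tA; rewrite /theta /hyperbolic /elliptic norm_tr_repr tA ltNge (ltW tA) /=.
case: asboolP => // /positive_parabolicP[K [B [dK /(tr_conj_translation dK)[tB _ _] BA]]].
have : `|\tr B| < 2 by case: BA => ->//; rewrite linearN normrN.
by rewrite tB gtr0_norm// ltxx.
Qed.

Lemma theta_positive_parabolic A : positive_parabolic (\pi_(PSL2 R) A) ->
  theta (\pi_(PSL2 R) A) = 0.
Proof. by move=> /asboolP pA; rewrite /theta pA orbT. Qed.

Lemma theta_negative_parabolic A : `|\tr A| = 2 -> ~ positive_parabolic (\pi_(PSL2 R) A) ->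
  theta (\pi_(PSL2 R) A) = 2 * pi.
Proof.
move=> tA npA; have pA : `[< positive_parabolic (\pi_(PSL2 R) A) >] = false by exact: asboolF.
by rewrite /theta /hyperbolic /elliptic norm_tr_repr tA ltxx pA.
Qed.

(** In the cases of trace 2 and -2, an eigenvector gives a point that the canonical
lift fixes, or moves by [- 2 * pi].  The matrix - 1 is an exception: [theta] is
[2 * pi] at the identity, but [back_lift (- 1)] has translation number
[- 2 * pi]. *)
Lemma back_lift_translation A : backward A -> (A : 'M[R]_2) != - 1%:M ->
  has_translation (back_lift A) (theta (\pi_(PSL2 R) A) - 2 * pi).
Proof.
move=> bA An1; have dA := SL2_det A; have pi0 := pi_gt0 R.
have hA := back_lift_is_lift dA bA.
have /and3P[c0 b0 tA] := bA.
have [tA2|tA2|tA2] := ltgtP `|\tr A| 2; last first.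
- have [trA|trA] : \tr A = 2 \/ \tr A = -2.
    by case: (ger0P (\tr A)) tA2; lra.
  + have [t At] : exists t, A *m RP1_cover t = 1 *: RP1_cover t :> 'cV[R]_2.
      by apply: eigendirection => //; rewrite trA; lra.
    have ft : back_lift A t = t.
      have [m mE] := carries_uniq (carries_eigen ltr01 At) (back_lift_carries t dA bA).
      have /andP[t1 t2] := back_lift_itv t dA.
      have m0 : m = 0.
        apply: (@intmul_small_eq0 R m (4 * pi)); first by lra.
        by rewrite ltr_norml; apply/andP; split; lra.
      by move: mE; rewrite m0 mul0r addr0.
    rewrite theta_negative_parabolic//.
      have := @fixed_translation R A (back_lift A) t 0 hA; rewrite mul0r addr0 subrr.
      exact.
    move=> /positive_parabolicP[K [B [dK /(tr_conj_translation dK)[tB B01 B10] BA]]].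
    case: BA tB B01 B10 => ->; last by rewrite linearN /= trA; lra.
    move=> _ b01 c10.
    have K11 : K 1 1 = 0.
      by apply/eqP; rewrite -sqrf_eq0 eq_le sqr_ge0 -b01 b0.
    have K10 : K 1 0 = 0.
      by apply/eqP; rewrite -sqrf_eq0 eq_le sqr_ge0 andbT -oppr_ge0 -c10 c0.
    by move: dK; rewrite det22 K11 K10 !mulr0 subr0 => /esym/eqP; rewrite oner_eq0.
  + have [t At] : exists t, A *m RP1_cover t = - 1 *: RP1_cover t :> 'cV[R]_2.
      by apply: eigendirection => //; rewrite trA; lra.
    have ft : back_lift A t = t - 2 * pi.
      have [m mE] := carries_uniq (carries_eigenN ltr01 At) (back_lift_carries t dA bA).
      have /andP[t1 t2] := back_lift_itv t dA.
      have m0 : m = 0.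
        apply: (@intmul_small_eq0 R m (4 * pi)); first by lra.
        by rewrite ltr_norml; apply/andP; split; lra.
      by move: mE; rewrite m0 mul0r addr0.
    rewrite theta_positive_parabolic//; last first.
      have [||||| K dK KA] := @conj_translation_exists R (- (A : 'M[R]_2)).
      - by rewrite det22N.
      - by rewrite linearN /= trA opprK.
      - by rewrite mxE; lra.
      - by rewrite mxE; lra.
      - by rewrite eqr_oppLR.
      have dK1 : \det K == 1 by apply/eqP.
      exact: (@positive_parabolic_intro R A (MkSL2 dK1)).
    have := @fixed_translation R A (back_lift A) t (-1) hA.
    by rewrite mulrN1z mulN1r sub0r; apply.
- by rewrite ltNge tA in tA2.
- rewrite theta_elliptic//.
  have /andP[a1 a2] : -1 < \tr A / 2 < 1.
    by move: tA2; rewrite ltr_norml => /andP[*]; apply/andP; split; lra.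
  pose b := acos (\tr A / 2).
  have cb : cos b = \tr A / 2 by rewrite acosK// in_itv/= !ltW.
  have bI : 0 < b < pi by rewrite acos_gt0 ?acos_ltpi ?a1 ?a2 ?ltW.
  have cp : 0 < A 1 0.
    rewrite lt_def c0 andbT; apply: contraTneq tA2 => c00.
    rewrite -leNgt -ler_sqr ?nnegrE// -normrX ger0_norm ?sqr_ge0//.
    move: dA; rewrite det22 c00 mulr0 subr0 tr22 => dA.
    have -> : 2 ^+ 2 = 4 * (A 0 0 * A 1 1) :> R by rewrite dA; ring.
    by rewrite -subr_ge0 (_ : _ - _ = (A 0 0 - A 1 1) ^+ 2) ?sqr_ge0//; ring.
  have trA : A 0 0 + A 1 1 = 2 * cos b by rewrite cb tr22; lra.
  rewrite (rotation_angleE cp bI trA).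
  have -> : 2 * pi - 2 * b - 2 * pi = - 2 * b by ring.
  exact: elliptic_translation.
Qed.

Lemma nonhyperbolic_backward A : `|\tr A| <= 2 ->
  exists2 B : SL2 R, \pi_(PSL2 R) B = \pi_(PSL2 R) A &
    backward B && ((B : 'M[R]_2) != - 1%:M).
Proof.
move=> tA.
suff [B BA bB] : exists2 B : SL2 R, \pi_(PSL2 R) B = \pi_(PSL2 R) A & backward B.
  have [B1|Bn1] := eqVneq (B : 'M[R]_2) (- 1%:M); last by exists B; rewrite ?bB.
  exists 1%g.
    rewrite -BA -[RHS]pi_SL2_opp; congr (\pi_(PSL2 R) _).
    by apply: val_inj; rewrite /= B1 opprK.
  rewrite /backward tr22 !mxE/= !mulr1n !mulr0n lexx /=; apply/andP; split.
    by rewrite ger0_norm; lra.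
  apply/eqP => /(congr1 (fun M : 'M[R]_2 => M 0 0)); rewrite !mxE/= mulr1n; lra.
have tr2 : (A 0 0 + A 1 1) ^+ 2 <= 4.
  have -> : 4 = 2 ^+ 2 :> R by ring.
  by rewrite -tr22 -[leLHS]ger0_norm ?sqr_ge0// normrX ler_sqr ?nnegrE//.
have bc : A 0 1 * A 1 0 <= 0.
  have := SL2_det A; rewrite det22 => dA.
  have := sqr_ge0 (A 0 0 - A 1 1); lra.
have [cp|cn|c0] := ltgtP 0 (A 1 0).
- by exists A => //; rewrite /backward (ltW cp) tA andbT/= -(pmulr_lle0 _ cp).
- exists (SL2_opp A); first exact: pi_SL2_opp.
  rewrite /backward /= linearN normrN tA !mxE oppr_ge0 (ltW cn) oppr_le0 andbT/=.
  by rewrite -(nmulr_lle0 _ cn).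
- have [b0|b0] := leP (A 0 1) 0; first by exists A; rewrite // /backward -c0 lexx b0 tA.
  exists (SL2_opp A); first exact: pi_SL2_opp.
  by rewrite /backward /= linearN normrN tA !mxE oppr_ge0 -c0 lexx oppr_le0 ltW.
Qed.

(** In the hyperbolic case, [h] is the lift that moves the fixed points on the boundary
by [- 2 * pi]. *)
Lemma theta_lift g : exists A : SL2 R, exists h : R -> R,
  [/\ \pi_(PSL2 R) A = g, is_lift A h, has_translation h (theta g - 2 * pi)
    & forall t, h t <= t].
Proof.
rewrite -(reprK g); set A := repr g; have dA := SL2_det A; have pi0 := pi_gt0 R.
have [tA|tA] := leP `|\tr A| 2.
  have [B <- /andP[bB B1]] := nonhyperbolic_backward tA.
  have dB := SL2_det B; exists B, (back_lift B); split => //.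
  - exact: back_lift_is_lift.
  - exact: back_lift_translation.
  - by move=> t; have /andP[] := back_lift_itv t dB.
rewrite theta_hyperbolic// sub0r.
have [B BA trB] : exists2 B : SL2 R, \pi_(PSL2 R) B = \pi_(PSL2 R) A & 2 < \tr B.
  have [t0|t0] := leP 0 (\tr A); first by exists A => //; rewrite ger0_norm in tA.
  by exists (SL2_opp A); [exact: pi_SL2_opp|rewrite /= linearN -ltr0_norm].
have dB := SL2_det B; rewrite -BA.
pose T := \tr B; pose l := (T + Num.sqrt (T ^+ 2 - 4)) / 2.
have T2 : 0 <= T ^+ 2 - 4.
  have -> : T ^+ 2 - 4 = (T - 2) * (T + 2) by ring.
  by rewrite mulr_ge0// /T; lra.
have sT := sqr_sqrtr T2; have s0 := sqrtr_ge0 (T ^+ 2 - 4).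
have l0 : 0 < l by rewrite /l /T divr_gt0//; lra.
have [t Bt] : exists t, B *m RP1_cover t = l *: RP1_cover t :> 'cV[R]_2.
  apply: eigendirection => //; rewrite -/T /l; move: sT; move: (Num.sqrt _) => s sT.
  by transitivity ((s ^+ 2 - (T ^+ 2 - 4)) / 4); [field|rewrite sT subrr mul0r].
have [f fB] := lift_exists dB.
have [m mE] := carries_uniq (lift_carries fB t) (carries_eigen l0 Bt).
have [C CB hC] := is_lift_shift (- (2 * m) - 1) fB.
set h := (fun s : R => _) in hC.
have ht : h t = t - 2 * pi by rewrite /h mE intrB intrN intrM; lra.
have [D DB hD] : exists2 D : SL2 R, \pi_(PSL2 R) D = \pi_(PSL2 R) B & is_lift D h.
  case: CB hC => -> hC; first by exists B.
  by exists (SL2_opp B); [exact: pi_SL2_opp|].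
exists D, h; split => //.
- have := @fixed_translation R D h t (-1) hD; rewrite mulrN1z mulN1r; exact.
- exact: lift_le_id hD ht.
Qed.

End ThetaTranslation.

(** * Homomorphisms from the fundamental group *)
Section WordEvaluation.
Variables (n : nat) (T : Type) (op : T -> T -> T) (e : T).
Hypotheses (opA : associative op) (op1 : left_id e op) (opr1 : right_id e op).
Variable F : 'I_n * bool -> T.
Hypothesis FV : forall i b, op (F (i, b)) (F (i, ~~ b)) = e.
Hypothesis F_boundary : foldr (fun i => op (F (i, true))) e (enum 'I_n) = e.

Definition word_eval (w : word n) : T := foldr (fun x => op (F x)) e w.

Lemma word_eval_cat v w : word_eval (v ++ w) = op (word_eval v) (word_eval w).
Proof. by elim: v => [|x v IHv] /=; rewrite ?op1// IHv opA. Qed.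

Lemma word_eval_rel v w : pi1_rel v w -> word_eval v = word_eval w.
Proof.
elim=> {v w} [//|v w _ ->//|u v w _ -> _ ->//|v v' w w' _ Ev _ Ew|i b|].
- by rewrite !word_eval_cat Ev Ew.
- by rewrite /word_eval /= opr1 FV.
- rewrite /word_eval foldr_map; exact: F_boundary.
Qed.

Lemma word_eval_repr (w : word n) : word_eval (repr (\pi_(pi1 n) w)) = word_eval w.
Proof. exact/word_eval_rel/pi1_repr_rel. Qed.

Lemma word_evalM (x y : pi1 n) :
  word_eval (repr (x * y)%g) = op (word_eval (repr x)) (word_eval (repr y)).
Proof.
by rewrite -word_eval_cat; exact: word_eval_repr.
Qed.

End WordEvaluation.

Section LiftInverse.
Variable R : realType.
Implicit Types (A : SL2 R) (f : R -> R).

Lemma lift_id f : lifts_elt f (1%g : PSL2 R) ->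
  exists m : int, forall t, f t = t + m%:~R * (2 * pi).
Proof. exact: (@lifts_elt_uniq R 1%g id f (is_lift_id R)). Qed.

Lemma lift_inverse A f : is_lift A f -> exists B : SL2 R, exists e : R -> R,
  [/\ \pi_(PSL2 R) B = (\pi_(PSL2 R) A)^-1%g, is_lift B e, e \o f = id & f \o e = id].
Proof.
move=> fA; have [e eV] := lift_exists (SL2_det A^-1%g).
have := is_lift_comp eV fA; rewrite (mulVmx (SL2_unitmx A)) => eA.
have [m mE] := is_lift_uniq eA (is_lift_id R).
have [B' BE hB] := is_lift_shift (- (2 * m)) eV.
set h := (fun s : R => _) in hB.
have hf : h \o f = id.
  by apply/funext => t; rewrite /h/= [e (f t)]mE intrN intrM; lra.
have fh : f \o h = id.
  apply/funext => s /=; have [t <-] := lift_surj s fA.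
  by rewrite -[h (f t)]/((h \o f) t) hf.
have [B BA hB'] : exists2 B : SL2 R, \pi_(PSL2 R) B = (\pi_(PSL2 R) A)^-1%g & is_lift B h.
  have VA : \pi_(PSL2 R) A^-1%g = (\pi_(PSL2 R) A)^-1%g by rewrite -PSL2_invE.
  case: BE hB => -> hB; first by exists A^-1%g.
  by exists (SL2_opp A^-1%g); rewrite ?pi_SL2_opp.
by exists B, h; split.
Qed.

End LiftInverse.

(** * The Euler class as the product of the distinguished lifts *)
Section EulerClass.
Variables (R : realType) (n : nat).
Implicit Types (rho : HomPSL2 R n) (h : 'I_n -> R -> R).

Lemma HomM rho x y : rho (x * y)%g = (rho x * rho y)%g.
Proof. exact: gmulfM. Qed.

Lemma Hom1 rho : rho 1%g = 1%g.
Proof. by apply: (mulgI (rho 1%g)); rewrite -HomM !mulg1. Qed.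

Lemma HomV rho x : rho x^-1%g = (rho x)^-1%g.
Proof. by apply: (mulgI (rho x)); rewrite -HomM !mulgV Hom1. Qed.

Lemma pi1_cons (i : 'I_n) (b : bool) (w : word n) : \pi_(pi1 n) ((i, b) :: w) =
  ((if b then pi1_loop i else (pi1_loop i)^-1) * \pi_(pi1 n) w)%g.
Proof.
case: b; first by rewrite -[RHS]/(pi1_mul _ _) pi1_mulE.
by rewrite -[RHS]/(pi1_mul (pi1_inv _) _) pi1_invE pi1_mulE.
Qed.

Lemma pi1_boundary : \pi_(pi1 n) [seq (i, true) | i <- enum 'I_n] = 1%g.
Proof. exact/pi1_eqP/pi1_rel_boundary. Qed.

Definition lift_prod h (s : seq 'I_n) : R -> R := foldr (fun i f => h i \o f) id s.

Lemma lift_prodD h h' (m : 'I_n -> int) (A : 'I_n -> SL2 R) s t :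
  (forall i, is_lift (A i) (h i)) ->
  (forall i t, h' i t = h i t + (m i)%:~R * (2 * pi)) ->
  lift_prod h' s t = lift_prod h s t + (\sum_(i <- s) m i)%:~R * (2 * pi).
Proof.
move=> hA hE; elim: s => [|i s IHs] /=; first by rewrite big_nil mul0r addr0.
rewrite IHs hE (liftD2piz _ _ (hA i)) big_cons intrD; ring.
Qed.

Definition sl2_prod (A : 'I_n -> SL2 R) (s : seq 'I_n) : SL2 R :=
  foldr (fun i B => A i * B)%g 1%g s.

Lemma pi_sl2_prod rho (A : 'I_n -> SL2 R) s :
  (forall i, \pi_(PSL2 R) (A i) = rho (pi1_loop i)) ->
  \pi_(PSL2 R) (sl2_prod A s) = rho (\pi_(pi1 n) [seq (i, true) | i <- s]).
Proof.
move=> Arho; elim: s => [|i s IHs] /=; first by symmetry; exact: Hom1.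
by rewrite pi1_cons HomM -IHs -Arho -PSL2_mulE.
Qed.

Lemma lift_prod_lift (A : 'I_n -> SL2 R) h s :
  (forall i, is_lift (A i) (h i)) -> is_lift (sl2_prod A s) (lift_prod h s).
Proof.
by move=> hA; elim: s => [|i s IHs] /=; [exact: is_lift_id|exact: is_lift_comp].
Qed.

(** The relation of the fundamental group lifts as soon as the product of the lifts
of the generators is the identity. *)
Lemma lifts_rep_exists rho (A : 'I_n -> SL2 R) h :
  (forall i, \pi_(PSL2 R) (A i) = rho (pi1_loop i)) ->
  (forall i, is_lift (A i) (h i)) -> lift_prod h (enum 'I_n) = id ->
  exists rhot, lifts_rep rhot rho.
Proof.
move=> Arho hA h1.
have /choice[B] := fun i => lift_inverse (hA i).
move=> /choice[e /all_and4[BE eB eh he]].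
pose F (x : 'I_n * bool) := if x.2 then h x.1 else e x.1.
have FV i b : F (i, b) \o F (i, ~~ b) = id by case: b; rewrite /F/=.
exists (fun x => word_eval comp id F (repr x)); split=> [x|x y]; last first.
  exact: word_evalM.
rewrite -{2}(reprK x); move: (repr x) => {x} w.
suff [C <- wC] : exists2 C : SL2 R, \pi_(PSL2 R) C = rho (\pi_(pi1 n) w) &
    is_lift C (word_eval comp id F w) by exact: is_lift_lifts_elt.
elim: w => [|[i b] w [C CE wC]].
  by exists 1%g; [symmetry; exact: Hom1|exact: is_lift_id].
rewrite pi1_cons HomM -CE; case: b => /=.
  exists (A i * C)%g; first by rewrite -Arho -PSL2_mulE.
  exact: (is_lift_comp (hA i) wC).
exists (B i * C)%g; first by rewrite HomV -Arho -BE -PSL2_mulE.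
exact: (is_lift_comp (eB i) wC).
Qed.

Lemma lifts_rep_prod rho rhot s : lifts_rep rhot rho ->
  rhot (\pi_(pi1 n) [seq (i, true) | i <- s]) =
  lift_prod (fun i => rhot (pi1_loop i)) s.
Proof.
move=> [rL rM].
have r1 : rhot 1%g = id.
  have := rL 1%g; rewrite Hom1 => /lift_id[m mE].
  have := rM 1%g 1%g; rewrite mulg1 => /(congr1 (@^~ 0)) /=.
  rewrite !mE add0r => m0; apply/funext => t; rewrite mE.
  by lra.
elim: s => [|i s IHs] /=; first exact: r1.
by rewrite pi1_cons rM IHs.
Qed.

(** The translation numbers of an arbitrary lifted representation differ from the
[theta (rho c_i) - 2 * pi] by multiples [2 * pi * m_i], and the relation forces the sum
of the m_i to compensate the product of the [h i].  That some lifted representation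
exists is seen by shifting the lift of the first generator. *)
Lemma euler_classE rho (A : 'I_n -> SL2 R) h : (0 < n)%N ->
  (forall i, \pi_(PSL2 R) (A i) = rho (pi1_loop i)) ->
  (forall i, is_lift (A i) (h i)) ->
  (forall i, has_translation (h i) (theta (rho (pi1_loop i)) - 2 * pi)) ->
  exists m : int, euler_class rho = n%:R - m%:~R /\
    forall t, lift_prod h (enum 'I_n) t = t - m%:~R * (2 * pi).
Proof.
move=> n0 Arho hA hT; have pi0 := pi_gt0 R.
have [k kE] : exists k : int, forall t, lift_prod h (enum 'I_n) t = t + k%:~R * (2 * pi).
  have := is_lift_lifts_elt (lift_prod_lift (enum 'I_n) hA).
  by rewrite (pi_sl2_prod _ Arho) pi1_boundary Hom1; exact: lift_id.
have shiftA (m : 'I_n -> int) : exists A' : 'I_n -> SL2 R,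
    (forall i, \pi_(PSL2 R) (A' i) = rho (pi1_loop i)) /\
    (forall i, is_lift (A' i) (fun t => h i t + (m i)%:~R * (2 * pi))).
  suff /choice[A' A'P] : forall i, exists B : SL2 R, \pi_(PSL2 R) B = rho (pi1_loop i) /\
      is_lift B (fun t => h i t + (m i)%:~R * (2 * pi)).
    by exists A'; split=> i; have [] := A'P i.
  move=> i; have [B] := is_lift_shift (m i) (hA i).
  case=> -> hB; first by exists (A i); split.
  by exists (SL2_opp (A i)); rewrite pi_SL2_opp; split.
have [rhot0 rhot0P] : exists rhot, lifts_rep rhot rho.
  pose i0 := Ordinal n0; pose m i := if i == i0 then - k else 0.
  have [A' [A'rho hA']] := shiftA m.
  apply: (lifts_rep_exists A'rho hA'); apply/funext => t.
  rewrite (lift_prodD _ _ hA (fun i t => erefl)) kE big_enum /=.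
  rewrite /m -big_mkcond big_pred1_eq intrN; lra.
have VolP : exists v, [set v | exists2 rhot, lifts_rep rhot rho &
    v = - \sum_(i < n) translation_number (rhot (pi1_loop i))] v.
  by exists (- \sum_(i < n) translation_number (rhot0 (pi1_loop i))), rhot0.
have [rhot rhotP VolE] := xgetPex 0 VolP.
have /choice[m mE] : forall i, exists m : int,
    forall t, rhot (pi1_loop i) t = h i t + m%:~R * (2 * pi).
  move=> i; apply: (lifts_elt_uniq (hA i)); rewrite Arho.
  exact: rhotP.1.
have sumE : k = - \sum_(i < n) m i.
  have := lift_prodD (enum 'I_n) 0 hA mE; rewrite -(lifts_rep_prod _ rhotP) pi1_boundary.
  rewrite -[1%g]/(\pi_(pi1 n) [seq (i, true) | i <- [::]]) (lifts_rep_prod _ rhotP) /=.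
  rewrite kE add0r -mulrDl -intrD => /esym/eqP.
  rewrite mulf_eq0 orbC gt_eqF/=; last by lra.
  by rewrite intr_eq0 addr_eq0 big_enum => /eqP.
exists (- k); split; last by move=> t; rewrite kE intrN; lra.
rewrite /euler_class /Vol VolE /Theta.
have TE i : translation_number (rhot (pi1_loop i)) =
    theta (rho (pi1_loop i)) - 2 * pi + (m i)%:~R * (2 * pi).
  apply: has_translationE; have := has_translation_shift (m i) (hA i) (hT i).
  by congr has_translation; apply/funext => t; rewrite mE.
rewrite (eq_bigr _ (fun i _ => TE i)) !big_split /= sumr_const card_ord -mulr_suml.
have sR : (\sum_(i < n) m i)%:~R = \sum_(i < n) (m i)%:~R :> R.
  exact: (big_morph (intr : int -> R) (@intrD R) (mulr0z 1)).
rewrite sumE opprK sR.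
move: (\sum_(i < n) theta _) (\sum_(i < n) _) => T M.
have p2 : 2 * pi != 0 :> R by rewrite gt_eqF//; lra.
by rewrite mulNrn -[_ *+ n]mulr_natr; apply: (canLR (mulfK p2)); ring.
Qed.

End EulerClass.

(** * Backward lifts with product one turn *)
Section Chain.
Variables (R : realType) (n : nat) (A : 'I_n -> SL2 R) (h : 'I_n -> R -> R).
Hypotheses (hA : forall i, is_lift (A i) (h i)) (h_le : forall i t, h i t <= t).

Lemma lift_prod_cat s1 s2 t :
  lift_prod h (s1 ++ s2) t = lift_prod h s1 (lift_prod h s2 t).
Proof. by elim: s1 => //= i s1 ->. Qed.

Lemma lift_prod_le s t : lift_prod h s t <= t.
Proof. by elim: s => //= i s IHs; apply: le_trans IHs; exact: h_le. Qed.

Lemma lift_prod_surj s x : exists t, lift_prod h s t = x.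
Proof.
elim: s x => [|i s IHs] x /=; first by exists x.
have [y yx] := lift_surj x (hA i).
by have [t ty] := IHs y; exists t; rewrite /= ty.
Qed.

(** All the factors move points backwards, so deleting the factors on the left and on
the right of [h i] in the product can only move the image forward. *)
Lemma factor_ge c i t : (forall t, lift_prod h (enum 'I_n) t = t - c) ->
  t - c <= h i t.
Proof.
move=> prodE; have [s1 [s2 E]] : exists s1 s2, enum 'I_n = s1 ++ i :: s2.
  have : i \in enum 'I_n by rewrite mem_enum.
  by move: (enum 'I_n) => s; case/splitPr => s1 s2; exists s1, s2.
have [x <-] := lift_prod_surj s2 t.
apply: (@le_trans _ _ (x - c)); first by rewrite lerD2r lift_prod_le.
by rewrite -prodE E lift_prod_cat; exact: lift_prod_le.
Qed.

Hypothesis h_prod : forall t, lift_prod h (enum 'I_n) t = t - 2 * pi.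

Lemma factor2_ge s1 i s2 j s3 t :
  enum 'I_n = s1 ++ i :: s2 ++ j :: s3 -> t - 2 * pi <= h i (h j t).
Proof.
move=> E; have [x <-] := lift_prod_surj s3 t.
apply: (@le_trans _ _ (x - 2 * pi)); first by rewrite lerD2r lift_prod_le.
rewrite -h_prod E lift_prod_cat /= lift_prod_cat /=.
apply: le_trans (lift_prod_le _ _) _; apply: (lift_le (hA i)).
exact: lift_prod_le.
Qed.

Lemma mem_split2 (T : eqType) (s : seq T) (i j : T) : i \in s -> j \in s -> i != j ->
  exists s1 s2 s3, s = s1 ++ i :: s2 ++ j :: s3 \/ s = s1 ++ j :: s2 ++ i :: s3.
Proof.
move=> si; case/splitPr: si => s1 s2; rewrite mem_cat in_cons eq_sym.
case/or3P => [sj|/eqP->|sj] ij; last 2 first.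
- by rewrite eqxx in ij.
- by case/splitPr: sj => s3 s4; exists s1, s3, s4; left.
by case/splitPr: sj => s3 s4; exists s3, s4, s2; right; rewrite -catA.
Qed.

Lemma factor_itv i t : t - 2 * pi <= h i t <= t.
Proof. by rewrite h_le factor_ge. Qed.

Lemma factor_backward i : backward (A i).
Proof. exact: carries_backward (SL2_det _) (lift_carries (hA i)) (factor_itv i). Qed.

Lemma factor2_tr i j : i != j -> `|\tr ((A i : 'M[R]_2) *m A j)| <= 2.
Proof.
have key k l s1 s2 s3 : enum 'I_n = s1 ++ k :: s2 ++ l :: s3 ->
    `|\tr ((A k : 'M[R]_2) *m A l)| <= 2.
  move=> E; have hAB := is_lift_comp (hA k) (hA l).
  suff /and3P[] : backward ((A k : 'M[R]_2) *m A l) by [].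
  apply: (carries_backward _ (lift_carries hAB)); first by rewrite det_mulmx !SL2_det mulr1.
  move=> t /=; rewrite (factor2_ge _ E)/=.
  by apply: le_trans (h_le _ _); exact: h_le.
move=> ij; have [s1 [s2 [s3 [/key//|/key]]]] := mem_split2 (mem_enum 'I_n i) (mem_enum 'I_n j) ij.
by rewrite mxtrace_mulC.
Qed.

End Chain.

(** * Simultaneous conjugation to bounded matrices *)
Section Balance.
Variable R : realType.

(** The determinant of (v, B v) equals that of (K v, K B v) = (K v, A K v). *)
Lemma quad_conj (A B K : 'M[R]_2) x y : \det K = 1 -> K *m B = A *m K ->
  quad B x y = quad A (K 0 0 * x + K 0 1 * y) (K 1 0 * x + K 1 1 * y).
Proof.
rewrite det22 => dK E.
have E00 : (K *m B) 0 0 = (A *m K) 0 0 by rewrite E.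
have E01 : (K *m B) 0 1 = (A *m K) 0 1 by rewrite E.
have E10 : (K *m B) 1 0 = (A *m K) 1 0 by rewrite E.
have E11 : (K *m B) 1 1 = (A *m K) 1 1 by rewrite E.
move: E00 E01 E10 E11; rewrite !mul22 /quad => E00 E01 E10 E11.
set X := K 0 0 * x + _; set Y := K 1 0 * x + _.
transitivity (((A 1 0 * K 0 0 + A 1 1 * K 1 0) * x + (A 1 0 * K 0 1 + A 1 1 * K 1 1) * y) * X
  - ((A 0 0 * K 0 0 + A 0 1 * K 1 0) * x + (A 0 0 * K 0 1 + A 0 1 * K 1 1) * y) * Y);
  last by rewrite /X /Y; ring.
rewrite -E00 -E01 -E10 -E11 -[LHS]mul1r -dK /X /Y; ring.
Qed.

(** The left-hand side is four times the polar form of the discriminant at the forms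
of A and B; it equals [\tr A * \tr B - 2 * \tr (A *m B)]. *)
Lemma polar_form_le (A B : SL2 R) : backward A -> backward B ->
  `|\tr ((A : 'M[R]_2) *m B)| <= 2 ->
  - 2 * (A 1 0 * B 0 1 + B 1 0 * A 0 1) - (A 1 1 - A 0 0) * (B 1 1 - B 0 0) <= 8.
Proof.
move=> /and3P[_ _ tA] /and3P[_ _ tB]; move: tA tB.
rewrite !tr22 !mul22 => tA tB tAB.
have tt : `|(A 0 0 + A 1 1) * (B 0 0 + B 1 1)| <= 4.
  have -> : 4 = 2 * 2 :> R by ring.
  by rewrite normrM ler_pM.
move: tt tAB; rewrite !ler_norml => /andP[_ h1] /andP[h2 _]; lra.
Qed.

(** The discriminant is a quadratic form in the coefficients; expand it at the sum. *)
Lemma quad_disc_le n (A : 'I_n -> SL2 R) (bA : forall i, backward (A i)) :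
  (forall i j, i != j -> `|\tr ((A i : 'M[R]_2) *m A j)| <= 2) ->
  (\sum_i A i 1 0) * (- \sum_i A i 0 1) - ((\sum_i (A i 1 1 - A i 0 0)) / 2) ^+ 2
   <= 2 * n%:R ^+ 2.
Proof.
move=> tA; pose c i := A i 1 0; pose b i := A i 0 1; pose m i := A i 1 1 - A i 0 0.
have term i j : - 2 * (c i * b j + c j * b i) - m i * m j <= 8.
  have [<-|ij] := eqVneq i j; last exact: polar_form_le (bA i) (bA j) (tA i j ij).
  rewrite /c /b /m; have := SL2_det (A i); rewrite det22.
  have := sqr_ge0 (A i 0 0 + A i 1 1); lra.
have sumE : \sum_i \sum_j (- 2 * (c i * b j + c j * b i) - m i * m j) =
    - 4 * ((\sum_i c i) * (\sum_i b i)) - (\sum_i m i) ^+ 2.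
  have inner i : \sum_j (- 2 * (c i * b j + c j * b i) - m i * m j) =
      - 2 * (c i * (\sum_j b j) + (\sum_j c j) * b i) - m i * \sum_j m j.
    by rewrite sumrB -!mulr_sumr big_split /= -mulr_sumr -mulr_suml.
  rewrite (eq_bigr _ (fun i _ => inner i)) sumrB -mulr_sumr big_split /=.
  by rewrite -mulr_suml -mulr_sumr -mulr_suml; ring.
have : \sum_i \sum_j (- 2 * (c i * b j + c j * b i) - m i * m j) <=
    \sum_(i < n) \sum_(j < n) (8 : R).
  by apply: ler_sum => i _; apply: ler_sum.
rewrite sumE !sumr_const card_ord -mulr_natr -[8 *+ n]mulr_natr.
by rewrite /c /b /m; lra.
Qed.

(** Let Q be the sum of the forms of the A_i plus [e * (x ^+ 2 + y ^+ 2)], where e > 0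
makes Q definite and is so small that its discriminant D grows by at most 1.  The
upper triangular K of determinant 1 that diagonalizes Q turns it into
[s * (x ^+ 2 + y ^+ 2)] with [s = sqrt D].  The form of each conjugated matrix lies
between 0 and this multiple of the norm, and its trace is at most 2 in absolute value:
this bounds its four entries. *)
Lemma balance n (A : 'I_n -> SL2 R) (bA : forall i, backward (A i)) :
  (forall i j, i != j -> `|\tr ((A i : 'M[R]_2) *m A j)| <= 2) ->
  exists K : SL2 R, forall i (B : 'M[R]_2), (K : 'M[R]_2) *m B = (A i : 'M[R]_2) *m K ->
    forall k l, `|B k l| <= 2 * n%:R ^+ 2 + 2.
Proof.
move=> tA; have := quad_disc_le bA tA.
set p := \sum_i A i 1 0; set b := \sum_i A i 0 1; set m := (_ / 2).
move=> D0.
have p0 : 0 <= p by apply: sumr_ge0 => i _; have /and3P[] := bA i.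
have b0 : b <= 0 by apply: sumr_le0 => i _; have /and3P[] := bA i.
(* Then [e * (p - b + e) <= 1], the growth of the discriminant. *)
pose e := (p - b + 1)^-1.
have q0 : 0 < p - b + 1 by lra.
have e0 : 0 < e by rewrite invr_gt0.
have eq : e * (p - b + 1) = 1 by rewrite mulVf// gt_eqF.
have e1 : e <= 1 by rewrite invf_le1//; lra.
pose P := p + e; pose S := - b + e; pose D := P * S - m ^+ 2.
have P0 : 0 < P by rewrite /P; lra.
pose Q x y := P * x ^+ 2 + 2 * m * x * y + S * y ^+ 2.
have QE x y : Q x y = \sum_i quad (A i) x y + e * (x ^+ 2 + y ^+ 2).
  rewrite /quad sumrB big_split /= -!mulr_suml -/p -/b.
  have -> : \sum_i (A i 1 1 - A i 0 0) = 2 * m by rewrite /m mulrC divfK.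
  by rewrite /Q /P /S; ring.
have quad0 i x y : 0 <= quad (A i) x y by apply: backward_quad (bA i); exact: SL2_det.
have Q_gt0 x y : 0 < x ^+ 2 + y ^+ 2 -> 0 < Q x y.
  by move=> xy; rewrite QE ltr_wpDl ?mulr_gt0// sumr_ge0.
have Q_ge i x y : quad (A i) x y <= Q x y.
  rewrite QE (bigD1 i)//= -addrA lerDl addr_ge0 ?sumr_ge0//.
  by rewrite mulr_ge0 ?(ltW e0)// addr_ge0 ?sqr_ge0.
(* Q is definite: evaluate it at [(- m, P)], where it is [P * D]. *)
have D_gt0 : 0 < D.
  have := Q_gt0 (- m) P; rewrite (_ : Q _ _ = P * D); last by rewrite /Q /D; ring.
  by rewrite (pmulr_rgt0 _ P0); apply; rewrite ltr_wpDl ?sqr_ge0// exprn_gt0.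
have D_le : D <= 2 * n%:R ^+ 2 + 1.
  have -> : D = (p * - b - m ^+ 2) + e * (p - b + e) by rewrite /D /P /S; ring.
  rewrite lerD// -eq ler_pM2l//; lra.
pose s := Num.sqrt D; have s0 : 0 < s by rewrite sqrtr_gt0.
have s2 : s ^+ 2 = D by rewrite sqr_sqrtr// ltW.
have s_le : s <= 2 * n%:R ^+ 2 + 1.
  have n0 : 0 <= 2 * n%:R ^+ 2 :> R by rewrite mulr_ge0// sqr_ge0.
  rewrite leNgt; apply/negP => sn.
  have : s * 1 < s * s by rewrite ltr_pM2l//; lra.
  by rewrite mulr1 -expr2 s2; lra.
pose k := Num.sqrt (s / P); have k0 : 0 < k by rewrite sqrtr_gt0 divr_gt0.
have kP : k ^+ 2 * P = s by rewrite sqr_sqrtr ?divfK ?gt_eqF// divr_ge0 ?ltW.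
have [kn Pn sn] : [/\ k != 0, P != 0 & s != 0] by rewrite !gt_eqF.
pose K := mx22 k (- m / (P * k)) 0 k^-1.
have dK : \det K == 1 by rewrite det22 !mx22E mulr0 subr0 divff.
have QK x y : Q (K 0 0 * x + K 0 1 * y) (K 1 0 * x + K 1 1 * y) = s * (x ^+ 2 + y ^+ 2).
  rewrite !mx22E.
  transitivity (k ^+ 2 * P * x ^+ 2 + (P * S - m ^+ 2) / (k ^+ 2 * P) * y ^+ 2).
    by rewrite /Q; field; rewrite kn Pn.
  by rewrite kP -/D -s2; field.
exists (MkSL2 dK) => i B KB.
have BQ x y : 0 <= quad B x y <= s * (x ^+ 2 + y ^+ 2).
  rewrite (quad_conj x y (eqP dK) KB) quad0 -QK.
  exact: Q_ge.
have tB : `|\tr B| <= 2.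
  have Ku : K \in unitmx by rewrite unitmxE (eqP dK) unitr1.
  have -> : B = invmx K *m ((A i : 'M[R]_2) *m K) by rewrite -KB mulKmx.
  by rewrite mxtrace_mulC mulmxK//; have /and3P[] := bA i.
move: (BQ 1 0) (BQ 0 1) (BQ 1 1) (BQ 1 (- 1)) tB.
rewrite /quad tr22 sqrrN !expr1n !expr0n /= !ler_norml.
move=> /andP[h1 h2] /andP[h3 h4] /andP[h5 h6] /andP[h7 h8] /andP[h9 h10].
by apply: ord2P; apply: ord2P; rewrite ler_norml; apply/andP; split; lra.
Qed.

End Balance.

(** * A compact set of tuples *)
Section Topology.
Variable R : realType.

Lemma SL2_entry_continuous (k l : 'I_2) : continuous (fun A : SL2 R => A k l).
Proof.
move=> A; have := @initial_continuous _ _ (@SL2_mx R) A => cA.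
apply: (@continuous_comp _ _ _ (@SL2_mx R) (fun M : 'M[R]_2 => M k l) A cA).
exact: coord_continuous.
Qed.

Lemma SL2_cvg (T : Type) (F : set_system T) (FF : Filter F) (f : T -> SL2 R) (A : SL2 R) :
  (forall k l, f x k l @[x --> F] --> A k l) -> f @ F --> A.
Proof.
move=> fA U [V [[W oW <-] WA] VU].
have : nbhs (SL2_mx A) W by apply: open_nbhs_nbhs.
move=> [P AP PW].
apply: (@filterS _ F _ [set x | forall k l, P k l (f x k l)]).
  by move=> x Px; apply: VU; apply: PW => k l; exact: Px.
by apply: filter_forall => k; apply: filter_forall => l; exact: fA (AP k l).
Qed.

Lemma SL2_bounded_compact (M : R) : compact [set A : SL2 R | forall k l, `|A k l| <= M].
Proof.
rewrite compact_ultra => F FU FM.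
have /choice[m mP] : forall kl : 'I_2 * 'I_2, exists m : R,
    `|m| <= M /\ (A : SL2 R) kl.1 kl.2 @[A --> F] --> m.
  move=> [k l] /=; have := @segment_compact R (- M) M.
  move=> /(_ (fmap (fun A : SL2 R => A k l) F)) [].
    rewrite /fmap/=; apply: (@filterS _ F _ _ _ _ FM) => A AM.
    by rewrite /= in_itv/= -ler_norml.
  move=> m [mI mC]; exists m; split; first by rewrite ler_norml; move: mI; rewrite /= in_itv/=.
  move=> U mU; have [//|FC] := in_ultra_setVsetC ((fun A : SL2 R => A k l) @^-1` U) FU.
  have [|x []] := mC (~` U) U _ mU; last by [].
  exact: FC.
pose B : 'M[R]_2 := \matrix_(k, l) m (k, l).
have FB k l : (A : SL2 R) k l @[A --> F] --> B k l by rewrite mxE; have [] := mP (k, l).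
have dB : \det B == 1.
  have : (fun A : SL2 R => \det A) @ F --> \det B.
    rewrite det22; under eq_cvg do rewrite det22.
    by apply: cvgB; apply: cvgM.
  under eq_cvg do rewrite SL2_det.
  move=> /(cvg_unique _ (cvg_cst (1 : R))) E; apply/eqP; rewrite -E //.
exists (MkSL2 dB); split.
  by move=> k l /=; rewrite mxE; have [] := mP (k, l).
exact: (@SL2_cvg _ F _ id).
Qed.

End Topology.

Section Compactness.
Variables (R : realType) (n : nat).
Implicit Types (A : 'I_n -> SL2 R) (rho : HomPSL2 R n).

Definition back_prod A (t : R) : R := lift_prod (fun i => back_lift (A i)) (enum 'I_n) t.

(** In the last condition it is enough to test the point 0, because the product is a
lift of - 1 and so is determined by one value. *)
Definition bounded_chain (M : R) : set {ptws 'I_n -> SL2 R} :=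
  [set A : 'I_n -> SL2 R | [/\ forall i, backward (A i), forall i k l, `|A i k l| <= M,
    sl2_prod A (enum 'I_n) = SL2_opp 1%g & back_prod A 0 = - (2 * pi)]].

Lemma entry_continuous i k l : continuous (fun A : {ptws 'I_n -> SL2 R} => A i k l).
Proof.
move=> A.
exact: continuous_comp (@proj_continuous 'I_n (fun=> SL2 R) i A)
  (@SL2_entry_continuous R k l (A i)).
Qed.

Lemma SL2_mulE (A B : SL2 R) k l : (A * B)%g k l = A k 0 * B 0 l + A k 1 * B 1 l.
Proof. exact: mul22. Qed.

Lemma bounded_chain_compact M : compact (bounded_chain M).
Proof.
pose cube := [set A : {ptws 'I_n -> SL2 R} |
  forall i, [set B : SL2 R | forall k l, `|B k l| <= M] (A i)].
have : compact cube.
  exact: (@tychonoff 'I_n (fun=> SL2 R) (fun=> _) (fun=> @SL2_bounded_compact R M)).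
rewrite !compact_ultra => cubeC F FU FK.
have Fcube : F cube by apply: (@filterS _ F _ _ _ _ FK) => A [_ AM _ _] i k l; exact: AM.
have [A0 [A0M /= FA0]] := cubeC F FU Fcube.
exists A0; split=> //.
have FP : ProperFilter F by exact: ultra_proper.
have cE i k l : (A : 'I_n -> SL2 R) i k l @[A --> F] --> A0 i k l.
  exact: (@cvg_comp _ _ _ (fun A => A) (fun A : {ptws 'I_n -> SL2 R} => A i k l)
    F (nbhs (A0 : {ptws 'I_n -> SL2 R})) _ FA0 (@entry_continuous i k l A0)).
split.
- move=> i; apply/and3P; split.
  + apply: (@closed_cvg _ _ F FP _ (fun x : R => 0 <= x) (@closed_ge _ 0) _ _ (cE i 1 0)).
    by apply: (@filterS _ F _ _ _ _ FK) => A [/(_ i)/and3P[]].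
  + apply: (@closed_cvg _ _ F FP _ (fun x : R => x <= 0) (@closed_le _ 0) _ _ (cE i 0 1)).
    by apply: (@filterS _ F _ _ _ _ FK) => A [/(_ i)/and3P[]].
  + have ctr : (fun A : 'I_n -> SL2 R => `|\tr (A i)|) @ F --> `|\tr (A0 i)|.
      apply: cvg_norm; rewrite tr22; under eq_cvg do rewrite tr22.
      by apply: cvgD.
    apply: (@closed_cvg _ _ F FP _ (fun x : R => x <= 2) (@closed_le _ 2) _ _ ctr).
    by apply: (@filterS _ F _ _ _ _ FK) => A [/(_ i)/and3P[]].
- exact: A0M.
- have cP s k l : (sl2_prod (A : 'I_n -> SL2 R) s) k l @[A --> F] --> sl2_prod A0 s k l.
    elim: s k l => [|i s IHs] k l; first exact: cvg_cst.
    rewrite /= -/(sl2_prod A0 s) SL2_mulE; under eq_cvg do rewrite /= SL2_mulE.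
    by apply: cvgD; apply: cvgM.
  apply: val_inj; apply/matrixP => k l.
  apply: (@closed_cvg _ _ F FP _ (fun x : R => x = (SL2_opp 1%g : SL2 R) k l)
    (@closed_eq _ _) _ _ (cP _ k l)).
  by apply: (@filterS _ F _ _ _ _ FK) => A [_ _ -> _].
- have cB s : lift_prod (fun i => back_lift ((A : 'I_n -> SL2 R) i)) s 0 @[A --> F] -->
      lift_prod (fun i => back_lift (A0 i)) s 0.
    elim: s => [|i s IHs]; first exact: cvg_cst.
    by apply: back_lift_cvg => //; exact: SL2_det.
  apply: (@closed_cvg _ _ F FP _ (fun x : R => x = - (2 * pi)) (@closed_eq _ _) _ _ (cB _)).
  by apply: (@filterS _ F _ _ _ _ FK) => A [].
Qed.

Definition letter A (x : 'I_n * bool) : SL2 R := if x.2 then A x.1 else (A x.1)^-1%g.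
Definition sl2_word A (w : word n) : SL2 R :=
  word_eval (fun B C : SL2 R => B * C)%g 1%g (letter A) w.

Lemma SL2_invE (A : SL2 R) : (A^-1)%g = mx22 (A 1 1) (- A 0 1) (- A 1 0) (A 0 0) :> 'M[R]_2.
Proof.
have := SL2_det A; rewrite det22 => dA; pose B := mx22 (A 1 1) (- A 0 1) (- A 1 0) (A 0 0).
have AB : (A : 'M[R]_2) *m B = 1%:M.
  apply: mx22P; rewrite !mul22 !mx22E !mxE /= ?mulr1n ?mulr0n -?dA; ring.
by rewrite -[RHS](mulKmx (SL2_unitmx A)) AB mulmx1.
Qed.

Lemma sl2_word_continuous (w : word n) :
  continuous (fun A : {ptws 'I_n -> SL2 R} => sl2_word A w).
Proof.
move=> A0; have FF := nbhs_filter (A0 : {ptws 'I_n -> SL2 R}).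
apply: (@SL2_cvg _ _ _ FF (fun A : {ptws 'I_n -> SL2 R} => sl2_word A w)).
have cE i k l : (A : {ptws 'I_n -> SL2 R}) i k l @[A --> A0] --> A0 i k l.
  exact: entry_continuous.
elim: w => [|[i b] w IHw] k l; first exact: (@cvg_cst _ _ _ _ FF).
rewrite /sl2_word /= -/(sl2_word A0 w) SL2_mulE; under eq_cvg do rewrite SL2_mulE.
have cL p q : (letter (A : {ptws 'I_n -> SL2 R}) (i, b)) p q @[A --> A0] --> letter A0 (i, b) p q.
  rewrite /letter/=; case: b; first exact: cE.
  have E00 (B : SL2 R) : (B^-1)%g 0 0 = B 1 1 by rewrite SL2_invE mx22E.
  have E01 (B : SL2 R) : (B^-1)%g 0 1 = - B 0 1 by rewrite SL2_invE mx22E.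
  have E10 (B : SL2 R) : (B^-1)%g 1 0 = - B 1 0 by rewrite SL2_invE mx22E.
  have E11 (B : SL2 R) : (B^-1)%g 1 1 = B 0 0 by rewrite SL2_invE mx22E.
  move: p q; apply: ord2P; apply: ord2P.
  - by rewrite E00; under eq_cvg do rewrite E00; exact: cE.
  - by rewrite E01; under eq_cvg do rewrite E01; apply: cvgN; exact: cE.
  - by rewrite E10; under eq_cvg do rewrite E10; apply: cvgN; exact: cE.
  - by rewrite E11; under eq_cvg do rewrite E11; exact: cE.
by apply: cvgD; apply: cvgM.
Qed.

End Compactness.

(** * Representations defined by tuples *)
Section ChainRepresentation.
Variables (R : realType) (n : nat).
Implicit Types (A : 'I_n -> SL2 R) (rho : HomPSL2 R n).

Lemma sl2_word_rho A rho : (forall i, \pi_(PSL2 R) (A i) = rho (pi1_loop i)) ->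
  forall x, rho x = \pi_(PSL2 R) (sl2_word A (repr x)).
Proof.
move=> Arho x; rewrite -{1}(reprK x); elim: (repr x) => [|[i b] w IHw]; first exact: Hom1.
rewrite pi1_cons HomM IHw /sl2_word /= -[RHS]PSL2_mulE; congr (_ * _)%g.
by rewrite /letter /=; case: b; rewrite ?HomV -Arho// -PSL2_invE.
Qed.

Lemma rep_exists A : sl2_prod A (enum 'I_n) = SL2_opp 1%g ->
  exists rho, (forall x, rho x = \pi_(PSL2 R) (sl2_word A (repr x))) /\
    forall i, \pi_(PSL2 R) (A i) = rho (pi1_loop i).
Proof.
move=> A1.
pose F (x : 'I_n * bool) := \pi_(PSL2 R) (letter A x).
have FV i b : (F (i, b) * F (i, ~~ b))%g = 1%g.
  rewrite /F -[LHS]/(PSL2_mul _ _) PSL2_mulE; congr (\pi_(PSL2 R) _).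
  by case: b; rewrite /letter/= ?mulgV ?mulVg.
have Fw (w : word n) : \pi_(PSL2 R) (sl2_word A w) =
    word_eval (fun B C : PSL2 R => B * C)%g 1%g F w.
  by elim: w => // x w IHw; rewrite /sl2_word /= -PSL2_mulE -IHw.
have Fb : foldr (fun i B => F (i, true) * B)%g 1%g (enum 'I_n) = 1%g.
  transitivity (\pi_(PSL2 R) (sl2_prod A (enum 'I_n))).
    by elim: (enum 'I_n) => // i s IHs; rewrite /sl2_prod /= -PSL2_mulE IHs.
  by rewrite A1 pi_SL2_opp.
pose f (x : pi1 n) := word_eval (fun B C : PSL2 R => B * C)%g 1%g F (repr x).
have fM : {morph f : x y / (x * y)%g}.
  exact: (word_evalM (@mulgA (PSL2 R)) (@mul1g _) (@mulg1 _) FV Fb).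
pose fm := isMultiplicative.Build _ _ f fM.
pose rho : {multiplicative pi1 n -> PSL2 R} := HB.pack f fm.
exists rho; split=> [x|i]; first by rewrite Fw.
by rewrite /= /f (word_eval_repr (@mulgA (PSL2 R)) (@mul1g _) (@mulg1 _) FV Fb) /= mulg1.
Qed.

Lemma ptws_cvg (I : choiceType) (V : topologicalType) (F : set_system (I -> V))
    (f : I -> V) : Filter F -> (forall i, (fun g : I -> V => g i) @ F --> f i) ->
  F --> (f : {ptws I -> V}).
Proof.
move=> FF Ff; apply/cvg_sup => i U [W [[Z oZ <-] Zf] WU].
by apply: filterS WU _; apply: (Ff i); exact: open_nbhs_nbhs.
Qed.

Lemma rep_continuous (K : set {ptws 'I_n -> SL2 R})
    (Phi : {ptws 'I_n -> SL2 R} -> HomPSL2 R n) :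
  (forall A, K A -> forall x, Phi A x = \pi_(PSL2 R) (sl2_word A (repr x))) ->
  {within K, continuous Phi}.
Proof.
move=> PhiE; apply: continuous_comp_initial => A.
apply: (@ptws_cvg (pi1 n) (PSL2 R)) => x.
have wc : continuous (fun B : {ptws 'I_n -> SL2 R} => \pi_(PSL2 R) (sl2_word B (repr x))).
  move=> B; apply: continuous_comp; first exact: sl2_word_continuous.
  exact: pi_continuous.
apply: (@subspace_eq_continuous _ K _ _ (fun B => Phi B x : PSL2 R) _
  (continuous_subspaceT wc)).
by move=> B /set_mem KB; rewrite PhiE.
Qed.

Lemma conjugate_pi rho sigma : conjugate rho sigma -> \pi_(Rep R n) rho = \pi_(Rep R n) sigma.
Proof. by move=> rs; apply/(@eqquotP _ (conjugate_equiv R n))/asboolP. Qed.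

Lemma backward1 : backward (1%:M : 'M[R]_2).
Proof. rewrite /backward tr22 !mxE/= !mulr1n !mulr0n lexx /= ger0_norm; lra. Qed.

Lemma backwardN1 : backward (- 1%:M : 'M[R]_2).
Proof. rewrite /backward tr22 !mxE/= !mulr1n !mulr0n oppr0 lexx /= ler0_norm; lra. Qed.

Lemma back_lift1 (t : R) : back_lift 1%:M t = t.
Proof.
have pi0 := pi_gt0 R; have d1 := det1 R 2.
have E := is_lift_eq (back_lift_is_lift d1 backward1) (is_lift_id R).
rewrite E// => s; have /andP[s1 s2] := back_lift_itv s d1.
by rewrite ltr_norml; apply/andP; split; lra.
Qed.

Lemma back_liftN1 (t : R) : back_lift (- 1%:M) t = t - 2 * pi.
Proof.
have pi0 := pi_gt0 R; have d1 : \det (- 1%:M : 'M[R]_2) = 1 by rewrite det22N det1.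
have E := is_lift_eq (back_lift_is_lift d1 backwardN1) (is_liftB2pi (is_lift_id R)).
rewrite E// => s; have /andP[s1 s2] := back_lift_itv s d1.
by rewrite ltr_norml; apply/andP; split; lra.
Qed.

(** All directions are eigendirections with positive eigenvalues. *)
Lemma carries_id (B : SL2 R) : (forall t, carries B t t) -> B = 1%g.
Proof.
move=> Bt; apply: val_inj => /=.
have /carriesP[r r0 []] := Bt 0; rewrite mul0r sin0 cos0 !mulr0 !add0r !mulr1 => b0 d0.
have pipi : pi / 2 / 2 = pi / 4 :> R by lra.
have /carriesP[s s0 []] := Bt pi; rewrite sin_pihalf cos_pihalf !mulr0 !addr0 !mulr1 => a0 c0.
have /carriesP[q q0 []] := Bt (pi / 2); rewrite pipi b0 c0 !mul0r addr0 add0r.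
have c4 : 0 < cos (pi / 4 : R).
  by have pi0 := pi_gt0 R; apply: cos_gt0_pihalf; apply/andP; split; lra.
have s4 : 0 < sin (pi / 4 : R).
  by have pi0 := pi_gt0 R; apply: sin_gt0_pihalf; apply/andP; split; lra.
move=> /(mulIf (lt0r_neq0 s4)) aq /(mulIf (lt0r_neq0 c4)) dq.
have := SL2_det B; rewrite det22 aq dq b0 c0 mul0r subr0 -expr2 => /eqP.
rewrite sqrf_eq1 => /orP[/eqP q1|/eqP q1]; last by rewrite q1 ltr0N1 in q0.
by apply: mx22P; rewrite !mxE ?aq ?dq ?q1 ?b0 ?c0.
Qed.

Lemma sl2_prodJ A (K : SL2 R) s : sl2_prod (fun i => A i ^ K)%g s = (sl2_prod A s ^ K)%g.
Proof. by elim: s => [|i s IHs] /=; rewrite ?conj1g// IHs conjMg. Qed.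

Lemma sl2_wordJ A (K : SL2 R) w : sl2_word (fun i => A i ^ K)%g w = (sl2_word A w ^ K)%g.
Proof.
elim: w => [|[i b] w IHw]; rewrite /sl2_word /= ?conj1g// -/(sl2_word _ w) IHw conjMg.
by congr (_ * _)%g; rewrite /letter/=; case: b; rewrite ?conjVg.
Qed.

Fact trivial_repM : {morph (fun _ : pi1 n => 1%g : PSL2 R) : x y / (x * y)%g}.
Proof. by move=> x y; rewrite mulg1. Qed.

Definition trivial_rep : HomPSL2 R n :=
  HB.pack_for {multiplicative pi1 n -> PSL2 R} (fun _ : pi1 n => 1%g : PSL2 R)
    (isMultiplicative.Build (pi1 n) (PSL2 R) (fun=> 1%g) trivial_repM).

End ChainRepresentation.

(** * Super-maximal representations are those of bounded tuples *)
Section SuperMaximal.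
Variables (R : realType) (n : nat).
Implicit Types (A : 'I_n -> SL2 R) (rho : HomPSL2 R n).

Lemma theta1 : theta (1%g : PSL2 R) = 2 * pi.
Proof.
have d1 := det1 R 2; have pi0 := pi_gt0 R.
rewrite theta_negative_parabolic//.
  rewrite /= tr22 !mxE/= !mulr1n ger0_norm //.
move=> /positive_parabolicP[K [B [dK /(tr_conj_translation dK)[tB B01 B10] BA]]].
have B0 : B 0 1 = 0 /\ B 1 0 = 0.
  by case: BA => ->; rewrite /= !mxE /= ?mulr0n ?oppr0.
have K11 : K 1 1 = 0.
  by apply/eqP; rewrite -sqrf_eq0 -B01; apply/eqP; case: B0.
have K10 : K 1 0 = 0.
  by apply/eqP; rewrite -sqrf_eq0 -oppr_eq0 -B10; apply/eqP; case: B0.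
by move: dK; rewrite det22 K11 K10 !mulr0 subr0 => /esym/eqP; rewrite oner_eq0.
Qed.

Lemma trivial_super_maximal rho : (0 < n)%N ->
  (forall i, rho (pi1_loop i) = 1%g) -> super_maximal rho.
Proof.
move=> n0 rho1.
have [|||m [mE prodE]] := @euler_classE R n rho (fun=> 1%g) (fun=> id) n0.
- by move=> i; rewrite rho1.
- by move=> i; exact: is_lift_id.
- move=> i; rewrite rho1 theta1 subrr; exists 0 => k.
  by rewrite mulr0 subr0; elim: k => [|k IHk] /=; rewrite ?normr0.
right; rewrite mE; have := prodE 0.
have -> : lift_prod (fun=> id : R -> R) (enum 'I_n) 0 = 0.
  by elim: (enum 'I_n).
have p2 : 2 * pi != 0 :> R by rewrite mulf_neq0// gt_eqF// pi_gt0.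
move=> /esym/eqP; rewrite sub0r oppr_eq0 mulf_eq0 (negbTE p2) orbF => /eqP ->.
by rewrite subr0.
Qed.

(** If some A_j is - 1, then [h j] already is the inverse of the full turn, which leaves
no room for the other factors: they are the identity, and rho is trivial.
Otherwise the canonical lifts are the distinguished ones, and their product shows
that the Euler class is n - 1. *)
Lemma bounded_chain_super_maximal M A rho : (0 < n)%N -> bounded_chain M A ->
  (forall i, \pi_(PSL2 R) (A i) = rho (pi1_loop i)) -> super_maximal rho.
Proof.
move=> n0 [bA _ prodA back0] Arho; have pi0 := pi_gt0 R.
pose h i := back_lift (A i).
have hA i : is_lift (A i) (h i) by apply: back_lift_is_lift (bA i); exact: SL2_det.
have h_le i t : h i t <= t by have /andP[] := back_lift_itv t (SL2_det (A i)).
have [/existsP[j /eqP Aj]|/existsPn An1] := boolP [exists j, (A j : 'M[R]_2) == - 1%:M].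
  apply: trivial_super_maximal => // i.
  have h_prod t : lift_prod h (enum 'I_n) t = t - 2 * pi.
    have hB := lift_prod_lift (enum 'I_n) hA; rewrite prodA in hB.
    have [m mE] := is_lift_uniq hB (is_liftB2pi (is_lift_id R)).
    have m0 : m%:~R * (4 * pi) = 0 :> R.
      by have := mE 0; rewrite -[lift_prod _ _ 0]/(back_prod A 0) back0; lra.
    by rewrite mE m0 addr0.
  have hj t : h j t = t - 2 * pi by rewrite /h Aj back_liftN1.
  have [->|ij] := eqVneq i j.
    rewrite -Arho -pi_SL2_opp; congr (\pi_(PSL2 R) _).
    by apply: val_inj; rewrite /= Aj opprK.
  have hi t : h i t = t.
    apply/eqP; rewrite eq_le h_le /=.
    have [s1 [s2 [s3 [E|E]]]] := mem_split2 (mem_enum 'I_n i) (mem_enum 'I_n j) ij.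
      have := factor2_ge hA h_le h_prod (t + 2 * pi) E; rewrite hj.
      by rewrite addrK.
    by have := factor2_ge hA h_le h_prod t E; rewrite hj; lra.
  have -> : rho (pi1_loop i) = \pi_(PSL2 R) (A i) by rewrite Arho.
  rewrite (_ : A i = 1%g)//; apply: carries_id => t.
  by have := lift_carries (hA i) t; rewrite hi.
have hT i : has_translation (h i) (theta (rho (pi1_loop i)) - 2 * pi).
  by rewrite -Arho; exact: back_lift_translation.
have [m [mE prodE]] := euler_classE n0 Arho hA hT.
left; rewrite mE; have := prodE 0; rewrite -[lift_prod _ _ 0]/(back_prod A 0) back0.
have p2 : 2 * pi != 0 :> R by rewrite mulf_neq0// gt_eqF.
rewrite sub0r => /oppr_inj; rewrite -[LHS]mul1r => /(mulIf p2) <-.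
by [].
Qed.

(** When the product of the distinguished lifts is the identity, rho is trivial and is
represented by the tuple (- 1, 1, ..., 1). *)
Lemma super_maximal_bounded_chain rho : (0 < n)%N -> super_maximal rho ->
  exists2 A, bounded_chain (2 * n%:R ^+ 2 + 2) A &
    exists g, forall x, \pi_(PSL2 R) (sl2_word A (repr x)) = (rho x ^ g)%g.
Proof.
move=> n0 rho_max; have pi0 := pi_gt0 R.
have /choice[A /choice[h /all_and4[Arho hA hT h_le]]] := fun i => theta_lift (rho (pi1_loop i)).
have [m [mE prodE]] := euler_classE n0 Arho hA hT.
have [m1|m0] : m = 1 \/ m = 0.
  case: rho_max; rewrite mE.
    by move=> E; left; apply/eqP; rewrite -(eqr_int R); apply/eqP; lra.
  by move=> E; right; apply/eqP; rewrite -(eqr_int R); apply/eqP; lra.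
- have h_prod t : lift_prod h (enum 'I_n) t = t - 2 * pi by rewrite prodE m1 mul1r.
  have bA := factor_backward hA h_le h_prod.
  have [K Kbound] := balance bA (factor2_tr hA h_le h_prod).
  pose B i := (A i ^ K)%g.
  have KB i : (K : 'M[R]_2) *m B i = (A i : 'M[R]_2) *m K.
    have : (K * B i = A i * K)%g by rewrite /B conjgE !mulgA mulgV mul1g.
    by move/(congr1 (@SL2_mx R)).
  have bB i : backward (B i).
    apply: quad_backward; first exact: SL2_det.
    move=> x y; rewrite (quad_conj x y (SL2_det K) (KB i)).
    by apply: backward_quad (bA i); exact: SL2_det.
  exists B; last first.
    exists (\pi_(PSL2 R) K) => x.
    by rewrite sl2_wordJ -PSL2_conjE -(sl2_word_rho Arho).
  split=> //.
  + by move=> i; exact: Kbound.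
  + rewrite sl2_prodJ.
    have -> : sl2_prod A (enum 'I_n) = SL2_opp 1%g.
      have := pi_sl2_prod (enum 'I_n) Arho; rewrite pi1_boundary Hom1 => /PSL2_eqP.
      case/orP => /eqP PE; last exact: val_inj.
      have := lift_carries (lift_prod_lift (enum 'I_n) hA) 0.
      rewrite PE h_prod => /(carries_uniq (lift_carries (is_lift_id R) 0))[k kE].
      have : (2 * k)%:~R = 1%:~R :> R.
        apply: (mulIf (lt0r_neq0 (_ : 0 < 2 * pi :> R))); first by lra.
        by rewrite intrM; lra.
      by move/eqP; rewrite eqr_int => /eqP; lia.
    apply: val_inj; rewrite conjgE /=.
    by rewrite mulNmx mul1mx mulmxN mulVmx ?SL2_unitmx.
  + have [k kK] := lift_exists (SL2_det K).
    (* The lift k of K intertwines the canonical lifts exactly, not only up to a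
       multiple of [4 * pi]. *)
    have step i t : k (back_lift (B i) t) = h i (k t).
      have hB := back_lift_is_lift (SL2_det (B i)) (bB i).
      have L1 := is_lift_comp kK hB; have L2 := is_lift_comp (hA i) kK.
      rewrite KB in L1; suff : k \o back_lift (B i) = h i \o k by move/(congr1 (@^~ t)).
      apply: (is_lift_eq L1 L2) => {}t /=.
      have /andP[b1 b2] := back_lift_itv t (SL2_det (B i)).
      have /andP[h1 h2] := factor_itv hA h_le h_prod i (k t).
      have k2 := lift_le kK b2.
      have k1 : k t - 2 * pi <= k (back_lift (B i) t).
        rewrite -[t in k t](subrK (2 * pi)) (liftD2pi kK) addrK.
        exact: (lift_le kK).
      by rewrite ltr_norml; apply/andP; split; lra.
    have kprod s t : k (lift_prod (fun i => back_lift (B i)) s t) = lift_prod h s (k t).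
      by elim: s => //= i s IHs; rewrite step IHs.
    apply: (is_lift_inj kK); rewrite /back_prod kprod h_prod.
    rewrite -[in LHS](addNr (2 * pi)) (liftD2pi kK); lra.
- have h1 i t : h i t = t.
    apply/eqP; rewrite eq_le h_le /=; have := @factor_ge _ _ _ _ hA h_le 0 i t.
    by rewrite subr0; apply=> {}t; rewrite prodE m0 mul0r.
  have A1 i : A i = 1%g.
    by apply: carries_id => t; have := lift_carries (hA i) t; rewrite h1.
  pose i0 := Ordinal n0.
  pose B i : SL2 R := if i == i0 then SL2_opp 1%g else 1%g.
  have B1 s : i0 \notin s -> sl2_prod B s = 1%g /\
      forall t, lift_prod (fun i => back_lift (B i)) s t = t.
    elim: s => [//|i s IHs]; rewrite in_cons negb_or eq_sym => /andP[/negbTE ii0 /IHs[IH1 IH2]].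
    rewrite /sl2_prod /= -/(sl2_prod B s) IH1 mulg1 /B ii0; split=> // t.
    by rewrite IH2 back_lift1.
  have [s [E i0s]] : exists s, enum 'I_n = i0 :: s /\ i0 \notin s.
    have := enum_uniq 'I_n; have : nth i0 (enum 'I_n) 0 = i0.
      by apply: val_inj; rewrite /= nth_enum_ord.
    have : (0 < size (enum 'I_n))%N by rewrite size_enum_ord.
    case: (enum 'I_n) => [//|j s] _ /= -> /andP[js _].
    by exists s.
  have [s1 s2] := B1 s i0s.
  have Bi0 : B i0 = SL2_opp 1%g by rewrite /B eqxx.
  have Brho i : \pi_(PSL2 R) (B i) = rho (pi1_loop i).
    by rewrite -Arho A1 /B; case: ifP => // _; rewrite pi_SL2_opp.
  exists B; last by exists 1%g => x; rewrite conjg1 (sl2_word_rho Brho).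
  split.
  + by move=> i; rewrite /B; case: ifP => _; [exact: backwardN1|exact: backward1].
  + move=> i k l; apply: (@le_trans _ _ 1); last by have := sqr_ge0 (n%:R : R); lra.
    by rewrite /B; case: ifP => _; rewrite /= !mxE ?normrN; case: (k == l);
      rewrite ?mulr1n ?mulr0n ?normr1 ?normr0.
  + by rewrite E -[sl2_prod _ _]/(B i0 * sl2_prod B s)%g s1 mulg1.
  + rewrite /back_prod E.
    rewrite -[lift_prod _ _ _]/(back_lift (B i0) (lift_prod (fun i => back_lift (B i)) s 0)).
    by rewrite s2 Bi0 back_liftN1 sub0r.
Qed.

End SuperMaximal.

(** The equivalence of the two notions of compactness holds in pointed spaces. *)
HB.instance Definition _ (R : realType) (n : nat) :=
  isPointed.Build (Rep R n) (\pi_(Rep R n) (trivial_rep R n)).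

Theorem corollary3 (R : realType) (n : nat) (hn : (3 <= n)%N) :
  cover_compact
    [set \pi_(Rep R n) rho | rho in [set rho : HomPSL2 R n | super_maximal rho]].
Proof.
have n0 : (0 < n)%N by exact: leq_trans hn.
pose K : set {ptws 'I_n -> SL2 R} := bounded_chain (2 * n%:R ^+ 2 + 2).
have /choice[Phi PhiP] : forall A : {ptws 'I_n -> SL2 R}, exists rho : HomPSL2 R n,
    K A -> (forall x, rho x = \pi_(PSL2 R) (sl2_word A (repr x))) /\
      forall i, \pi_(PSL2 R) (A i) = rho (pi1_loop i).
  move=> A; have [KA|nKA] := pselect (K A); last by exists (trivial_rep R n).
  have [_ _ A1 _] := KA; have [rho rhoP] := rep_exists A1.
  by exists rho.
have PhiE A : K A -> forall x, Phi A x = \pi_(PSL2 R) (sl2_word A (repr x)).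
  by move=> /PhiP[].
have -> : [set \pi_(Rep R n) rho | rho in [set rho : HomPSL2 R n | super_maximal rho]] =
    (\pi_(Rep R n) \o Phi) @` K.
  apply/seteqP; split=> [_ [rho rho_max <-]|_ [A KA <-]].
    have [A KA [g gE]] := super_maximal_bounded_chain n0 rho_max.
    exists A => //; symmetry; apply: conjugate_pi; exists g => x.
    by rewrite PhiE// gE.
  exists (Phi A) => //.
  exact: bounded_chain_super_maximal n0 KA (PhiP A KA).2.
rewrite -compact_cover; apply: continuous_compact; last exact: bounded_chain_compact.
have cPhi := rep_continuous PhiE.
move=> A; apply: (@continuous_comp _ _ _ (Phi : subspace K -> HomPSL2 R n) (\pi_(Rep R n)) A).
  exact: cPhi.
exact: pi_continuous.
Qed.
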